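(* Let $n\in\mathbb{N}$, $\theta,\eta\in\mathbb{R}$, $\alpha,\gamma\in[0,2\pi)$ and $a\in(-1,1)$. Let $F_{(a,\alpha)}=H_{(a,\alpha)}+\overline{G_{(a,\alpha)}}\in S_{H(\alpha)}$ be given by $$H_{(a,\alpha)}(z)+e^{-2i\alpha}G_{(a,\alpha)}(z)=\frac{z}{1-ze^{i\alpha}},\qquad \frac{G_{(a,\alpha)}'(z)}{H_{(a,\alpha)}'(z)}=e^{2i\alpha}\left(\frac{a-ze^{i\alpha}}{1-aze^{i\alpha}}\right).$$ Let $T_{(\eta,\gamma)}=R_{(\eta,\gamma)}+\overline{S_{(\eta,\gamma)}}\in S_H$ be given by $$R_{(\eta,\gamma)}(z)+e^{-2i\gamma}S_{(\eta,\gamma)}(z)=f(z),\qquad \frac{S_{(\eta,\gamma)}'(z)}{R_{(\eta,\gamma)}'(z)}=e^{i\theta}z^n,$$ where $f$ is the analytic mapping in $\mathbb{D}$ given by $$zf'(z)=\frac{z}{(1+ze^{i(\eta+\gamma)})(1+ze^{-i(\eta-\gamma)})}.$$ Then $F_{(a,\alpha)}\,\tilde{\ast}\,T_{(\eta,\gamma)}\in S_H$ and is convex in the direction of $-(\alpha+\gamma)$ for $a\in\left[\frac{n-2}{n+2},1\right)$.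
   Context: $\mathbb{D}=\{z\in\mathbb{C}:|z|<1\}$. $S_H$ is the class of complex-valued univalent harmonic functions $f=h+\overline{g}$ in $\mathbb{D}$ ($h,g$ analytic in $\mathbb{D}$) normalized by $h(0)=g(0)=0=h'(0)-1$. For $\alpha\in[0,2\pi)$, $S_{H(\alpha)}$ is the family of all slanted right half plane mappings, i.e. harmonic mappings $h+\overline{g}$ with $h(z)+e^{-2i\alpha}g(z)=\frac{z}{1-e^{i\alpha}z}$, which map $\mathbb{D}$ onto the slanted half plane $\{w\in\mathbb{C}:\mathrm{Re}(e^{i\alpha}w)>-1/2\}$. The Hadamard product of analytic functions $z+\sum_{k\ge2}a_kz^k$ and $z+\sum_{k\ge2}A_kz^k$ is $z+\sum_{k\ge2}a_kA_kz^k$; in general $\ast$ denotes the coefficientwise product of power series. The convolution of harmonic mappings $h+\overline{g}$ and $H+\overline{G}$ is $(h+\overline{g})\,\tilde{\ast}\,(H+\overline{G})=h\ast H+\overline{g\ast G}$. A domain $E\subset\mathbb{C}$ is convex in the direction $\psi$ (directions taken modulo $\pi$) if every line parallel to the line through $0$ and $e^{i\psi}$ has an empty or connected intersection with $E$; a function is convex in the direction of $\psi$ if it maps $\mathbb{D}$ onto a domain convex in the direction $\psi$.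
   Formalization: Since H'(0)=1/(1+a) and R'(0)=1, the convolution has derivative 1/(1+a) at 0, so F∗T∈S_H fails literally for a≠0; the formal theorem shows that (1+a)(F∗T) is in S_H, and that F∗T itself is convex in the direction −(α+γ). *)

(* Defs.v *)
From HB Require Import structures.
From mathcomp Require Import all_boot all_order all_algebra.
From mathcomp Require Import complex.
From mathcomp Require Import all_classical all_reals all_analysis.

Set Implicit Arguments.
Unset Strict Implicit.
Unset Printing Implicit Defensive.

Import Order.TTheory GRing.Theory Num.Theory.
Import numFieldNormedType.Exports.

Local Open Scope classical_set_scope.
Local Open Scope ring_scope.
Local Open Scope complex_scope.

(* As a module over itself, R[i]^o carries the topology of the complex modulus.
   The norm is R[i]-valued, but `|z| < 1 is the usual strict inequality, because
   `|z| is always a real element of R[i]. *)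

Definition cis (R : realType) (t : R) : R[i] := cos t +i* sin t.

Definition unit_disk (R : realType) : set R[i] := [set z | `|z| < 1].

Definition analytic_on_disk (R : realType) (f : R[i] -> R[i]) : Prop :=
  forall z : R[i]^o, unit_disk z -> derivable (f : R[i]^o -> R[i]^o) z 1.

Definition cderive (R : realType) (f : R[i] -> R[i]) : R[i] -> R[i] :=
  derive1 (f : R[i] -> R[i]^o).

(* The harmonic mapping h + conj g. Its analytic and co-analytic parts are kept
   as a pair (h, g), since the convolution below is defined on the parts. *)
Definition harmonic_map (R : realType) (h g : R[i] -> R[i]) : R[i] -> R[i] :=
  fun z => h z + (g z)^*.

Definition S_H (R : realType) (h g : R[i] -> R[i]) : Prop :=
  [/\ analytic_on_disk h /\ analytic_on_disk g,
      set_inj (@unit_disk R) (harmonic_map h g),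
      h 0 = 0, g 0 = 0 & cderive h 0 = 1].

Definition slanted_half_plane (R : realType) (alpha : R) : set R[i] :=
  [set w | - 2^-1 < complex.Re (cis alpha * w)].

Definition S_Hslanted (R : realType) (alpha : R) (h g : R[i] -> R[i]) : Prop :=
  [/\ analytic_on_disk h /\ analytic_on_disk g,
      forall z, unit_disk z ->
        h z + cis (- 2 * alpha) * g z = z / (1 - cis alpha * z) &
      harmonic_map h g @` (@unit_disk R) = slanted_half_plane alpha].

(* Division is total with x / 0 = 0, so h' <> 0 has to be stated separately. *)
Definition has_dilatation (R : realType) (h g omega : R[i] -> R[i]) : Prop :=
  forall z, unit_disk z -> cderive h z != 0 /\ cderive g z / cderive h z = omega z.

Definition taylor_coef (R : realType) (f : R[i] -> R[i]) (k : nat) : R[i] :=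
  derive1n k (f : R[i] -> R[i]^o) 0 / k`!%:R.

Definition hadamard (R : realType) (f g : R[i] -> R[i]) : R[i] -> R[i] :=
  fun z => limn (series (fun k =>
    taylor_coef f k * taylor_coef g k * z ^+ k : R[i]^o)).

Definition line (R : realType) (w : R[i]) (psi : R) : set R[i] :=
  [set w + t%:C * cis psi | t in [set: R]].

(* [connected] holds of the empty set. *)
Definition convex_in_direction (R : realType) (E : set R[i]^o) (psi : R) : Prop :=
  forall w, connected (E `&` line w psi).

Definition maps_convex_in_direction (R : realType) (F : R[i] -> R[i]) (psi : R)
    : Prop :=
  let E : set R[i]^o := F @` (@unit_disk R) in
  [/\ open E, connected E & convex_in_direction E psi].

(* Main.v *)
(* Put w = z e^(i alpha), u = w e^(i gamma), c = (1 - a)/(1 + a), so that the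
   bound on a reads c n <= 2.  Solving the two shear equations for H and G and
   comparing coefficients gives
     P(z) = e^(-i alpha)/2 (T1(w) + c w T1'(w)),
     Q(z) = e^(i alpha)/2 (T2(w) - c w T2'(w)),
   hence, up to the constant e^(-i(alpha + gamma))/2, the convolution is the map
   u |-> A(u) + conj(B(u)) with A' = g (1 - m + b) and B' = s g (1 - m - b), where
   q = 1 + 2 cos(eta) u + u^2, s = mu u^n with |mu| = 1, g = 1/(q (1 + s)), m = c n/2
   and b = c (1 - u^2)/q + m (1 - s)/(1 + s).  Since Re b > 0 and m <= 1, |B'| < |A'|.
   Moreover (A' - B') q = (1 - s)/(1 + s) + c (1 - u^2)/q has positive real part, so
   V = Im(A - B) increases along every integral curve of the field i q; these
   curves foliate the disk.  The term c > 0 makes V run from -oo to +oo on each of them,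
   because Im(u/q), a primitive of Im((1 - u^2)/q^2), does.  Every level
   set of V is thus a graph over the leaf space, and U = Re(A + B) is increasing on it
   because the Jacobian |A'|^2 - |B'|^2 is positive.  This yields univalence and
   convexity in the horizontal direction at once.

   All the functions involved are given by rational derivatives, so their power
   series come from division by 1 - zeta z^m and termwise differentiation; no Cauchy
   theory is needed. *)

Require Import Defs.
From HB Require Import structures.
From mathcomp Require Import all_boot all_order all_algebra.
From mathcomp Require Import complex ring lra.
From mathcomp Require Import all_classical all_reals all_analysis.

Set Implicit Arguments.
Unset Strict Implicit.
Unset Printing Implicit Defensive.

Import Order.TTheory GRing.Theory Num.Theory.
Import numFieldNormedType.Exports.

Local Open Scope classical_set_scope.
Local Open Scope ring_scope.
Local Open Scope complex_scope.

(** * Complex derivatives *)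

(** A quotient-free form of differentiability: it serves real and complex functions alike, yields
    Lipschitz estimates directly and allows [h = 0]. *)
Definition cder (K : numFieldType) (f : K -> K) (z d : K) : Prop :=
  forall e : K, 0 < e -> exists2 r : K, 0 < r &
    forall h, `|h| < r -> `|f (z + h) - f z - d * h| <= e * `|h|.

Section EpsilonDerivative.
Variable K : numFieldType.
Implicit Types (f g : K -> K) (z d : K).

Lemma cderP f z d :
  cder f z d <-> is_derive (z : K^o) 1 (f : K^o -> K^o) d.
Proof.
split => [fd|[dv dE] e e0].
  have H : h^-1 *: (((f : K^o -> K^o) \o shift (z : K^o)) (h *: (1 : K^o)) - f z)
     @[h --> (0 : K^o)^'] --> (d : K^o).
    apply/cvgrPdist_le => e e0.
    have [r r0 hr] := fd e e0.
    near=> h.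
    have h0 : h != 0 by near: h; exact: (@nbhs_dnbhs_neq (K^o) 0).
    have hl : `|h| < r.
      by near: h; exact: (@dnbhs0_lt _ (K^o)).
    rewrite /= -normrN opprB.
    rewrite -(ler_pM2r (x := `|h|)) ?normr_gt0 // -normrM.
    have := hr h hl; rewrite mulrBl -[_ *: _]/(_ * _) mulrAC mulVf // mul1r.
    by rewrite -[h *: 1]/(h * 1) mulr1 [z + h]addrC.
  split; first by apply/cvg_ex; exists d.
  exact/cvg_lim.
have H : h^-1 *: (((f : K^o -> K^o) \o shift (z : K^o)) (h *: (1 : K^o)) - f z)
     @[h --> (0 : K^o)^'] --> (d : K^o) by rewrite -dE.
move/cvgrPdist_le : H => /(_ e e0).
rewrite /dnbhs near_withinE => /nbhs_ballP[r /= r0 hr].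
exists r => // h hl.
have [->|h0] := eqVneq h 0; first by rewrite addr0 mulr0 !subrr normr0 mulr0.
have := hr h; rewrite /ball /= sub0r normrN => /(_ hl h0).
rewrite -normrN opprB -(ler_pM2r (x := `|h|)) ?normr_gt0 // -normrM.
rewrite mulrBl -[_ *: _]/(_ * _) mulrAC mulVf // mul1r.
by rewrite -[h *: 1]/(h * 1) mulr1 [z + h]addrC.
Unshelve. all: by end_near. Qed.

Lemma cder_derivable f z d :
  cder f z d -> derivable (f : K^o -> K^o) z 1.
Proof. by move/cderP => []. Qed.

Lemma cder_uniq f z d d' : cder f z d -> cder f z d' -> d = d'.
Proof. by move=> /cderP[_ <-] /cderP[_ <-]. Qed.

Lemma cder_eq f z d d' : cder f z d -> d = d' -> cder f z d'.
Proof. by move=> + <-. Qed.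

Lemma cder_cst (c : K) z : cder (fun=> c) z 0.
Proof. by apply/cderP; exact: is_derive_cst. Qed.

Lemma cder_id z : cder id z 1.
Proof. by apply/cderP; exact: is_derive_id. Qed.

Lemma cderD f g z d d' :
  cder f z d -> cder g z d' -> cder (fun x => f x + g x) z (d + d').
Proof. by move=> /cderP a /cderP b; apply/cderP; exact: is_deriveD. Qed.

Lemma cderB f g z d d' :
  cder f z d -> cder g z d' -> cder (fun x => f x - g x) z (d - d').
Proof. by move=> /cderP a /cderP b; apply/cderP; exact: is_deriveB. Qed.

Lemma cderM f g z d d' : cder f z d -> cder g z d' ->
  cder (fun x => f x * g x) z (f z * d' + g z * d).
Proof. by move=> /cderP a /cderP b; apply/cderP; exact: is_deriveM. Qed.

Lemma cderX f n z d : cder f z d ->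
  cder (fun x => f x ^+ n) z (n%:R * f z ^+ n.-1 * d).
Proof.
move=> fd; elim: n => [|n /(cderM fd) IH].
  by apply: cder_eq (cder_cst _ z) _; rewrite !mul0r.
have -> : (fun x => f x ^+ n.+1) = fun x => f x * f x ^+ n.
  by apply/funext => x; rewrite exprS.
apply: cder_eq IH _; case: n => [|n]; first by rewrite expr0; ring.
by rewrite /= exprS -[n.+2%:R]natr1; ring.
Qed.

Lemma cderZ (c : K) f z d : cder f z d -> cder (fun x => c * f x) z (c * d).
Proof.
by move=> /(cderM (cder_cst c z)) /cder_eq; apply; rewrite mulr0 addr0.
Qed.

Lemma cderV f z d : f z != 0 -> cder f z d ->
  cder (fun x => (f x)^-1) z (- (d / f z ^+ 2)).
Proof.
move=> fz0 /cderP [df fd]; apply/cderP; split; first exact: derivableV.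
by rewrite deriveV // fd /GRing.scale /= mulrC mulrN.
Qed.

Lemma cder_lip f z d : cder f z d -> exists2 r : K, 0 < r &
  forall h, `|h| < r -> `|f (z + h) - f z| <= (`|d| + 1) * `|h|.
Proof.
move=> /(_ 1 ltr01)[r r0 hr]; exists r => // h /hr; rewrite mul1r => hh.
rewrite -[X in `|X|](subrK (d * h)) addrC mulrDl mul1r.
by rewrite (le_trans (ler_normD _ _))// lerD// normrM.
Qed.

Lemma cder_comp f g z d d' : cder g z d -> cder f (g z) d' ->
  cder (f \o g) z (d' * d).
Proof.
move=> gd fd e e0.
have [r1 r10 lip] := cder_lip gd.
have K0 : 0 < `|d| + 1 by rewrite ltr_wpDl.
have K'0 : 0 < `|d'| + 1 by rewrite ltr_wpDl.
(* Each of the two errors gets half of [e]: [|d| + 1] is a local Lipschitz constant of [g], and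
   [|d'| + 1] bounds the outer derivative and is nonzero. *)
have e1 : 0 < e / 2 / (`|d| + 1) by rewrite !divr_gt0.
have e2 : 0 < e / 2 / (`|d'| + 1) by rewrite !divr_gt0.
have [r2 r20 h2] := fd _ e1.
have [r3 r30 h3] := gd _ e2.
(* The order of [K] may be partial, so minima of radii require comparability, which positivity
   provides. *)
have r1r : r1 \is Num.real by rewrite gtr0_real.
have r3r : r3 \is Num.real by rewrite gtr0_real.
have r2r : r2 / (`|d| + 1) \is Num.real by rewrite gtr0_real ?divr_gt0.
exists (Num.min (Num.min r1 r3) (r2 / (`|d| + 1))).
  by rewrite !comparable_lt_min ?real_comparable ?min_real // r10 r30 divr_gt0.
move=> h.
rewrite !comparable_lt_min ?real_comparable ?min_real // => /andP[/andP[hr1 hr3] hr2].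
have k2 : `|g (z + h) - g z| < r2.
  by rewrite (le_lt_trans (lip _ hr1))// mulrC -ltr_pdivlMr.
have := h2 _ k2; rewrite subrKC => hf.
have -> : (f \o g) (z + h) - (f \o g) z - d' * d * h =
  (f (g (z + h)) - f (g z) - d' * (g (z + h) - g z)) +
  d' * (g (z + h) - g z - d * h) by rewrite /=; ring.
rewrite (le_trans (ler_normD _ _))//.
have -> : e * `|h| = e / 2 / (`|d| + 1) * ((`|d| + 1) * `|h|) + (`|d'| + 1) * (e / 2 / (`|d'| + 1) * `|h|).
  field; rewrite !gt_eqF //.
rewrite lerD//; first by rewrite (le_trans hf)// ler_wpM2l ?lip// ltW.
rewrite normrM ler_pM// ?h3//.
by rewrite lerDl.
Qed.

Lemma cder_near f g z d : (\forall x \near (z : K^o), f x = g x) ->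
  cder f z d -> cder g z d.
Proof. by move=> fg /cderP fd; apply/cderP; exact: near_eq_is_derive fd. Qed.

End EpsilonDerivative.

Section DiskDerivative.
Variable R : realType.
Implicit Types (f g : R[i] -> R[i]) (z d : R[i]).

Lemma cderiveE f z d : cder f z d -> cderive f z = d.
Proof. by move/cderP => [_ fd]; rewrite /cderive derive1E. Qed.

Lemma derivable_cder f z :
  derivable (f : R[i]^o -> R[i]^o) z 1 -> cder f z (cderive f z).
Proof. by move=> fz; apply/cderP; rewrite /cderive derive1E; exact: derivableP. Qed.

Lemma near_disk z : unit_disk z -> \forall x \near (z : R[i]^o), unit_disk x.
Proof.
rewrite /unit_disk /= => z1; apply/nbhs_ballP; exists (1 - `|z|) => /=.
  by rewrite subr_gt0.
move=> x; rewrite /ball /= => zx.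
by rewrite -(subrK z x) (le_lt_trans (ler_normD _ _))// -ltrBrDr distrC.
Qed.

Lemma cder_disk f g z d : (forall x, unit_disk x -> f x = g x) -> unit_disk z ->
  cder f z d -> cder g z d.
Proof.
by move=> fg z1; apply: cder_near; apply: filterS (near_disk z1) => x /fg.
Qed.

Lemma unit_disk0 : @unit_disk R 0.
Proof. by rewrite /unit_disk /= normr0 ltr01. Qed.

End DiskDerivative.
Lemma rderP (R : realType) (f : R -> R) (x d : R) :
  cder f x d <-> is_derive x (1 : R) f d.
Proof. exact: (cderP f x d). Qed.

(** * Power series on the unit disk *)

Lemma normc_le_ReIm (R : realType) (z : R[i]) :
  `|z| <= (`|complex.Re z| + `|complex.Im z|)%:C.
Proof.
rewrite {1}[z]complexE (le_trans (ler_normD _ _))// rmorphD /= lerD//.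
  by rewrite normc_def /= expr0n addr0 sqrtr_sqr.
by rewrite normrM !normc_def /= expr0n add0r expr1n sqrtr1 mul1r addr0 sqrtr_sqr.
Qed.

Lemma normc_ge_Im (R : realType) (z : R[i]) : `|complex.Im z|%:C <= `|z|.
Proof.
rewrite normc_def lecR -sqrtr_sqr ler_wsqrtr//.
by rewrite lerDr sqr_ge0.
Qed.

Lemma Re_sum (R : realType) I (r : seq I) (P : pred I) (F : I -> R[i]) :
  complex.Re (\sum_(i <- r | P i) F i) = \sum_(i <- r | P i) complex.Re (F i).
Proof. by elim/big_rec2: _ => // i x y _ <-; case: (F i) y => ? ? []. Qed.

Lemma Im_sum (R : realType) I (r : seq I) (P : pred I) (F : I -> R[i]) :
  complex.Im (\sum_(i <- r | P i) F i) = \sum_(i <- r | P i) complex.Im (F i).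
Proof. by elim/big_rec2: _ => // i x y _ <-; case: (F i) y => ? ? []. Qed.

Definition psum (R : realType) (b : nat -> R[i]) (z : R[i]) : R[i] :=
  limn (series (fun k => b k * z ^+ k : R[i]^o)).

(** Absolute convergence on every disk of radius below 1, expressed by bounded partial sums. The
    radius lives in [R[i]] because the modulus does. *)
Definition tame (R : realType) (b : nat -> R[i]) : Prop :=
  forall rho : R[i], 0 <= rho -> rho < 1 ->
  exists M, forall N, \sum_(k < N) `|b k| * rho ^+ k <= M.

Section PowerSeries.
Variable R : realType.
Implicit Types (b d : nat -> R[i]) (f : R[i] -> R[i]) (z : R[i]).

Lemma real_abs_cvg (a : nat -> R) (M : R) :
  (forall N, \sum_(k < N) `|a k| <= M) -> cvgn (series a).
Proof.
move=> aM; apply: normed_cvg; apply: nondecreasing_is_cvgn.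
  move=> m n mn; rewrite /series /=.
  by rewrite [leRHS](big_cat_nat (n := m)) //= lerDl sumr_ge0.
by exists M => _ [N _ <-]; have := aM N; rewrite -(big_mkord xpredT (fun k => `|a k|)).
Qed.

(** Real and imaginary parts are dominated by the modulus, so both real series converge absolutely,
    and their limits form the complex limit. *)
Lemma complex_abs_cvg (a : nat -> R[i]) (M : R[i]) :
  (forall N, \sum_(k < N) `|a k| <= M) -> cvgn (series (a : nat -> R[i]^o)).
Proof.
move=> aM.
have ReM N : \sum_(k < N) complex.Re `|a k| <= complex.Re M.
  by have := aM N; rewrite lecE => /andP[_]; rewrite Re_sum.
have cre : cvgn (series (fun k => complex.Re (a k))).
  apply: (@real_abs_cvg _ (complex.Re M)) => N; apply: le_trans (ReM N).
  apply: ler_sum => k _.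
  by have := normc_ge_Re (a k); rewrite lecE => /andP[].
have cim : cvgn (series (fun k => complex.Im (a k))).
  apply: (@real_abs_cvg _ (complex.Re M)) => N; apply: le_trans (ReM N).
  apply: ler_sum => k _.
  by have := normc_ge_Im (a k); rewrite lecE => /andP[].
set x := limn (series (fun k => complex.Re (a k))).
set y := limn (series (fun k => complex.Im (a k))).
apply/cvg_ex; exists (x +i* y); apply/cvgrPdist_lt => e e0.
have eR : e = (complex.Re e)%:C by rewrite RRe_real // gtr0_real.
have e20 : 0 < complex.Re e / 2 by rewrite divr_gt0// -ltcR -eR.
have /cvgrPdist_lt/(_ _ e20) hx := cre.
have /cvgrPdist_lt/(_ _ e20) hy := cim.
near=> N.
rewrite (le_lt_trans (normc_le_ReIm _))// eR ltcR [ltRHS]splitr ltrD//=.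
  have -> : complex.Re (x +i* y - series (a : nat -> R[i]^o) N) =
      x - series (fun k => complex.Re (a k)) N.
    by rewrite raddfB /= /series /= Re_sum.
  by near: N.
have -> : complex.Im (x +i* y - series (a : nat -> R[i]^o) N) =
    y - series (fun k => complex.Im (a k)) N.
  by rewrite raddfB /= /series /= Im_sum.
by near: N.
Unshelve. all: by end_near. Qed.

End PowerSeries.

Section PowerSeriesCalculus.
Variable R : realType.
Implicit Types (b d : nat -> R[i]) (f : R[i] -> R[i]) (z : R[i]).

Lemma tame_cvg b z : tame b -> unit_disk z ->
  series (fun k => b k * z ^+ k : R[i]^o) @ \oo --> (psum b z : R[i]^o).
Proof.
move=> tb z1; have [M HM] := tb `|z| (normr_ge0 _) z1.
apply: (@complex_abs_cvg _ _ M) => N.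
by under eq_bigr do rewrite normrM normrX.
Qed.

Lemma psum_eq b z l :
  series (fun k => b k * z ^+ k : R[i]^o) @ \oo --> (l : R[i]^o) -> psum b z = l.
Proof. exact: cvg_lim. Qed.

Lemma psum_finite b n z : (forall k, (n <= k)%N -> b k = 0) ->
  psum b z = \sum_(k < n) b k * z ^+ k.
Proof.
move=> b0; apply: psum_eq; apply: cvg_near_cst.
exists n => // N /= nN; rewrite /series /= (big_cat_nat (n := n)) //= big_mkord.
rewrite [X in _ + X]big_nat_cond [X in _ + X]big1 ?addr0// => k /andP[/andP[nk _] _].
by rewrite b0 // mul0r.
Qed.

Lemma tame_finite b n : (forall k, (n <= k)%N -> b k = 0) -> tame b.
Proof.
move=> b0 rho r0 r1; exists (\sum_(k < n) `|b k| * rho ^+ k) => N.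
rewrite -!(big_mkord xpredT (fun k => `|b k| * rho ^+ k)).
have [nN|Nn] := leqP n N.
  rewrite (big_cat_nat (n := n)) //= big_nat_cond.
  rewrite [X in _ + X]big_nat_cond [X in _ + X]big1 ?addr0 -?big_nat_cond// => k /andP[/andP[nk _] _].
  by rewrite b0 // normr0 mul0r.
rewrite [leRHS](big_cat_nat (n := N)) //= ?(ltnW Nn)// lerDl sumr_ge0 // => k _.
by rewrite mulr_ge0// exprn_ge0.
Qed.

Section Division.
Variables (b d : nat -> R[i]) (zeta : R[i]) (m : nat).
Hypotheses (m_gt0 : (0 < m)%N) (zeta1 : `|zeta| <= 1) (tb : tame b).
Hypotheses (d_lt : forall k, (k < m)%N -> d k = b k).
Hypotheses (d_ge : forall k, d (m + k)%N = b (m + k)%N + zeta * d k).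

(** The recursion is that of the quotient of [b] by 1 - zeta z^m. It gives D <= M + rho^m D for the
    weighted partial sums, whence D <= M / (1 - rho^m). *)
Lemma tame_div : tame d.
Proof.
move=> rho r0 r1; have [M HM] := tb r0 r1.
have q1 : rho ^+ m < 1 by rewrite exprn_ilt1 // -lt0n.
exists (M / (1 - rho ^+ m)) => N.
rewrite ler_pdivlMr ?subr_gt0// mulrBr mulr1 lerBlDr.
set D := \sum_(k < N) _.
(* With [m] extra terms, the first [m] fall under [d_lt] and the other [N] under [d_ge]. *)
have : D <= \sum_(k < m + N) `|d k| * rho ^+ k.
  rewrite /D -!(big_mkord xpredT (fun k => `|d k| * rho ^+ k)).
  rewrite [leRHS](big_cat_nat (n := N)) ?leq_addl//= lerDl sumr_ge0 // => k _.
  by rewrite mulr_ge0// exprn_ge0.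
move/le_trans; apply; rewrite (le_trans _ (lerD (HM (m + N)%N) (lexx _)))//.
rewrite !big_split_ord /= -addrA lerD//.
  by apply: ler_sum => k _; rewrite d_lt.
rewrite /D mulr_suml -big_split /=; apply: ler_sum => k _.
rewrite d_ge exprD -mulrA.
have -> : `|d k| * (rho ^+ k * rho ^+ m) = `|d k| * (rho ^+ m * rho ^+ k).
  by rewrite [rho ^+ k * _]mulrC.
rewrite -mulrDl ler_wpM2r ?mulr_ge0 ?exprn_ge0//.
by rewrite (le_trans (ler_normD _ _))// lerD2l normrM ler_piMl.
Qed.

(** Passage to the limit in S_d(N + m) = S_b(N + m) + zeta z^m S_d(N), a form that avoids
    subtraction of indices. *)
Lemma psum_div z : unit_disk z -> psum d z * (1 - zeta * z ^+ m) = psum b z.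
Proof.
move=> z1; have cd := tame_cvg tame_div z1; have cb := tame_cvg tb z1.
apply/eqP; rewrite mulrBr mulr1 subr_eq; apply/eqP.
have cd' : (fun N => series (fun k => d k * z ^+ k : R[i]^o) (N + m)%N) @ \oo
  --> (psum d z : R[i]^o) by rewrite -(cvg_shiftn m) in cd.
have cb' : (fun N => series (fun k => b k * z ^+ k : R[i]^o) (N + m)%N) @ \oo
  --> (psum b z : R[i]^o) by rewrite -(cvg_shiftn m) in cb.
have E : (fun N => series (fun k => d k * z ^+ k : R[i]^o) (N + m)%N) =
  (fun N => series (fun k => b k * z ^+ k : R[i]^o) (N + m)%N) \+
  (fun N => series (fun k => d k * z ^+ k : R[i]^o) N * (zeta * z ^+ m)).
  apply/funext => N /=; rewrite /series /= !big_mkord addnC !big_split_ord /= -addrA.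
  congr (_ + _); first by apply: eq_bigr => k _; rewrite d_lt.
  rewrite mulr_suml -big_split /=; apply: eq_bigr => k _.
  by rewrite d_ge exprD; ring.
have cs : (fun N => series (fun k => d k * z ^+ k : R[i]^o) (N + m)%N) @ \oo
    --> (psum b z + psum d z * (zeta * z ^+ m) : R[i]^o).
  rewrite E; apply: cvgD; first exact: cb'.
  by apply: (@cvgM _ _ _ _ _ (cst (zeta * z ^+ m))); [exact: cd|exact: cvg_cst].
exact: etrans (esym (cvg_lim (@norm_hausdorff _ (R[i]^o)) cd')) (cvg_lim (@norm_hausdorff _ (R[i]^o)) cs).
Qed.

End Division.

End PowerSeriesCalculus.

(** * Termwise differentiation of power series *)

Definition shiftd (R : realType) (b : nat -> R[i]) (k : nat) : R[i] :=
  k.+1%:R * b k.+1.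

Section PsumDerivative.
Variable R : realType.
Implicit Types (b d : nat -> R[i]) (f : R[i] -> R[i]) (z : R[i]).

(** Absorbs the factor k of a differentiated power by passing from radius [r] to a larger [s], at
    the cost of 1/(s - r). *)
Lemma exprn_gap (K : numDomainType) (r s : K) k : 0 <= r -> r <= s ->
  k%:R * r ^+ k.-1 * (s - r) <= s ^+ k.
Proof.
move=> r0 rs; have sr0 : 0 <= s - r by rewrite subr_ge0.
have s0 := le_trans r0 rs.
elim: k => [|[|k] IH]; first by rewrite !mul0r exprn_ge0.
  by rewrite !mul1r expr1 lerBlDr lerDl.
have -> : k.+2%:R * r ^+ k.+1 * (s - r) =
    r * (k.+1%:R * r ^+ k.+1.-1 * (s - r)) + r ^+ k.+1 * (s - r).
  by rewrite -natr1 /= exprS; ring.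
have -> : s ^+ k.+2 = r * s ^+ k.+1 + s ^+ k.+1 * (s - r) by rewrite exprS; ring.
by rewrite lerD ?ler_wpM2l ?ler_wpM2r// lerXn2r ?nnegrE.
Qed.

(* With A_k = (z+h)^k - z^k - k z^(k-1) h one has
   A_(k+1) = (z+h) A_k + k z^(k-1) h^2. *)
Lemma taylor2_exprn (K : numFieldType) (z h r s : K) k :
  `|z| <= r -> `|z + h| <= r -> r < s ->
  `|(z + h) ^+ k - z ^+ k - k%:R * z ^+ k.-1 * h| <=
    `|h| ^+ 2 * (s ^+ k / (s - r) ^+ 2).
Proof.
move=> zr zhr rs.
have r0 : 0 <= r by apply: le_trans zr.
have sr0 : 0 < s - r by rewrite subr_gt0.
elim: k => [|k IH].
  by rewrite !expr0 !mul0r subrr subr0 normr0 mul1r mulr_ge0 ?invr_ge0 ?exprn_ge0// ltW.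
have -> : (z + h) ^+ k.+1 - z ^+ k.+1 - k.+1%:R * z ^+ k.+1.-1 * h =
  (z + h) * ((z + h) ^+ k - z ^+ k - k%:R * z ^+ k.-1 * h) + (k%:R * z ^+ k.-1) * h ^+ 2.
  by case: k {IH} => [|k]; rewrite ?expr0 -1?natr1 /= !exprS; ring.
rewrite (le_trans (ler_normD _ _))// !normrM.
have -> : `|h| ^+ 2 * (s ^+ k.+1 / (s - r) ^+ 2) =
  r * (`|h| ^+ 2 * (s ^+ k / (s - r) ^+ 2)) + s ^+ k / (s - r) * `|h| ^+ 2.
  by rewrite [s ^+ k.+1]exprS; move: (`|h|) => x; field; rewrite gt_eqF.
rewrite lerD//; first by rewrite ler_pM.
rewrite !normrX ler_wpM2r ?exprn_ge0// normr_nat ler_pdivlMr//.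
rewrite (le_trans _ (exprn_gap _ r0 (ltW rs)))// ler_wpM2r ?(ltW sr0)// ler_wpM2l//.
by rewrite lerXn2r ?nnegrE.
Qed.

Lemma tame_shiftd b : tame b -> tame (shiftd b).
Proof.
(* The midpoint of r and 1 leaves room for the gap estimate and stays where [b] is tame. *)
move=> tb r r0 r1; pose s := (r + 1) / 2.
have rs : r < s by rewrite ltr_pdivlMr// mulr_natr mulr2n ltrD2l.
have s1 : s < 1 by rewrite ltr_pdivrMr// mul1r ltrD2r.
have [M HM] := tb s (ltW (le_lt_trans r0 rs)) s1.
have sr0 : 0 < s - r by rewrite subr_gt0.
exists (M / (s - r)) => N; rewrite ler_pdivlMr//.
apply: le_trans (HM N.+1); rewrite big_ord_recl /= ler_wpDl//.
  by rewrite mulr_ge0// expr0.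
rewrite mulr_suml; apply: ler_sum => k _; rewrite /bump /= add1n.
rewrite /shiftd normrM normr_nat.
have -> : k.+1%:R * `|b k.+1| * r ^+ k * (s - r) =
  `|b k.+1| * (k.+1%:R * r ^+ k.+1.-1 * (s - r)) by rewrite /=; ring.
by rewrite ler_wpM2l// exprn_gap// ltW.
Qed.

Lemma norm_lim_le (u : nat -> R[i]^o) (l : R[i]^o) (B : R[i]) :
  u @ \oo --> l -> (forall N, `|u N| <= B) -> `|l| <= B.
Proof.
move=> /(cvgrPdist_lt u l).1 ul uB.
have B0 : 0 <= B by apply: le_trans (uB 0%N).
rewrite real_leNgt ?ger0_real//; apply/negP => Bl.
have e0 : 0 < `|l| - B by rewrite subr_gt0.
have [N _ /(_ N (leqnn _))] := ul _ e0.
rewrite /= ltrBrDr => H.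
have : `|l| < `|l|.
  rewrite -[X in `|X| < _](subrK (u N)) (le_lt_trans (ler_normD _ _))//.
  by rewrite (le_lt_trans _ H)// lerD2l.
by rewrite ltxx.
Qed.

(** Summing the second-order bound of [taylor2_exprn] gives a remainder of at most |h|^2 M / (s -
    r)^2, which is o(h). *)
Lemma psum_cder b z : tame b -> unit_disk z ->
  cder (psum b) z (psum (shiftd b) z).
Proof.
(* The radii r and s cut the interval from |z| to 1 into thirds: z + h stays within r, and the
   coefficients are summed at s. *)
move=> tb z1 e e0; pose r := (2 * `|z| + 1) / 3; pose s := (`|z| + 2) / 3.
have d1 : 0 < (1 - `|z|) / 3 by rewrite divr_gt0// subr_gt0.
have zr : r - `|z| = (1 - `|z|) / 3 by rewrite /r; field.
have rs : s - r = (1 - `|z|) / 3 by rewrite /r /s; field.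
have s1 : 1 - s = (1 - `|z|) / 3 by rewrite /s; field.
have {}zr : `|z| < r by rewrite -subr_gt0 zr.
have sr0 : 0 < s - r by rewrite rs.
have {}rs : r < s by rewrite -subr_gt0.
have {}s1 : s < 1 by rewrite -subr_gt0 s1.
have r0 : 0 <= r := ltW (le_lt_trans (normr_ge0 _) zr).
have s0 : 0 <= s := le_trans r0 (ltW rs).
have [M HM] := tb s s0 s1.
have M0 : 0 <= M by apply: le_trans (HM 0%N); rewrite big_ord0.
have bnd h : `|h| < r - `|z| -> `|psum b (z + h) - psum b z - psum (shiftd b) z * h| <=
   `|h| ^+ 2 * (M / (s - r) ^+ 2).
  rewrite ltrBrDr addrC => hr.
  have zhr : `|z + h| <= r by rewrite (le_trans (ler_normD _ _))// ltW.
  have zh1 : unit_disk (z + h).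
    by rewrite /unit_disk /=; apply: le_lt_trans zhr (lt_trans rs s1).
  have c1 := tame_cvg tb zh1; have c2 := tame_cvg tb z1.
  have c3 := tame_cvg (tame_shiftd tb) z1.
  (* N terms of the derived series match N + 1 terms of the original one, whose constant term
     cancels in the difference. *)
  rewrite -(cvg_shiftn 1) in c1; rewrite -(cvg_shiftn 1) in c2.
  apply: (@norm_lim_le (fun N =>
    series (fun k => b k * (z + h) ^+ k : R[i]^o) (N + 1)%N
    - series (fun k => b k * z ^+ k : R[i]^o) (N + 1)%N
    - series (fun k => shiftd b k * z ^+ k : R[i]^o) N * h)).
    apply: cvgB; first by apply: cvgB; [exact: c1|exact: c2].
    by apply: (@cvgM _ _ _ _ _ (cst h)); [exact: c3|exact: cvg_cst].
  move=> N; rewrite /series /= !big_mkord.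
  have -> : \sum_(k < N) shiftd b k * z ^+ k =
     \sum_(k < N + 1) b k * (k%:R * z ^+ k.-1).
    rewrite addn1 big_ord_recl /= mul0r mulr0 add0r; apply: eq_bigr => k _.
    by rewrite /bump /= add1n /shiftd; ring.
  rewrite mulr_suml -!sumrB (le_trans (ler_norm_sum _ _ _))//.
  apply: (@le_trans _ _ (\sum_(k < N + 1) (`|b k| * s ^+ k) * (`|h| ^+ 2 / (s - r) ^+ 2))).
    apply: ler_sum => k _.
    rewrite -mulrBr -[b k * _ * h]mulrA -mulrBr normrM -[leRHS]mulrA ler_wpM2l//.
    rewrite (le_trans (taylor2_exprn k (ltW zr) zhr rs))//.
    by rewrite (_ : `|h| ^+ 2 * (s ^+ k / (s - r) ^+ 2) = s ^+ k * (`|h| ^+ 2 / (s - r) ^+ 2)) //; ring.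
  rewrite -mulr_suml.
  have -> : `|h| ^+ 2 * (M / (s - r) ^+ 2) = M * (`|h| ^+ 2 / (s - r) ^+ 2) by ring.
  by rewrite ler_wpM2r// divr_ge0 ?exprn_ge0// ltW.
have K0 : 0 < M / (s - r) ^+ 2 + 1.
  by rewrite ltr_wpDl// divr_ge0 ?exprn_ge0// ltW.
have e1 : 0 < e / (M / (s - r) ^+ 2 + 1) by rewrite divr_gt0.
have zr0 : 0 < r - `|z| by rewrite subr_gt0.
exists (Num.min (r - `|z|) (e / (M / (s - r) ^+ 2 + 1))).
  by rewrite comparable_lt_min ?real_comparable ?gtr0_real// zr0.
move=> h; rewrite comparable_lt_min ?real_comparable ?gtr0_real// => /andP[h1 h2].
rewrite (le_trans (bnd _ h1))// expr2 -mulrA mulrC ler_wpM2r//.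
move: h2; rewrite ltr_pdivlMr// => /ltW; apply: le_trans.
by rewrite ler_wpM2l// lerDl.
Qed.

End PsumDerivative.

(** * Termwise integration and Taylor coefficients *)

Section Taylor.
Variable R : realType.
Implicit Types (b d : nat -> R[i]) (f g : R[i] -> R[i]) (z : R[i]).

Lemma zero_derive_segment (phi : R -> R) :
  (forall t, 0 <= t -> t <= 1 -> cder phi t 0) -> phi 1 = phi 0.
Proof.
move=> dphi.
have [|||x _] := @MVT_segment R phi (fun=> 0) 0 1.
- exact: ler01.
- by move=> x /andP[x0 x1]; apply/rderP/dphi; exact: ltW.
- apply: derivable_within_continuous => x; rewrite in_itv /= => /andP[x0 x1].
  by have /rderP[] := dphi _ x0 x1.
by rewrite mul0r => /eqP; rewrite subr_eq0 => /eqP.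
Qed.

(** Along the radius t z the real and imaginary parts of [g] have zero derivative, so the real mean
    value theorem applies to each. *)
Lemma zero_cder_disk g z : (forall x, unit_disk x -> cder g x 0) ->
  unit_disk z -> g z = g 0.
Proof.
move=> dg z1.
have gt0 (t e : R) : 0 <= t -> t <= 1 -> 0 < e -> exists2 r : R, 0 < r &
    forall h, `|h| < r -> `|g ((t + h)%:C * z) - g (t%:C * z)| <= (e * `|h|)%:C.
  move=> t0 t1 e0.
  have tz1 : unit_disk (t%:C * z).
    rewrite /unit_disk /= normrM (le_lt_trans _ z1)// ler_piMl//.
    by rewrite ger0_norm ?ler0c// -[1]/(1%:C) lecR.
  have e0' : 0 < e%:C by rewrite -[0]/(0%:C) ltcR.
  have [r r0 hr] := dg _ tz1 _ e0'.
  have rR : r = (complex.Re r)%:C by rewrite RRe_real // gtr0_real.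
  exists (complex.Re r); first by rewrite -ltcR -rR.
  move=> h hh.
  have hE : `|h%:C| = `|h|%:C :> R[i].
    by rewrite normc_def /= expr0n addr0 sqrtr_sqr.
  have hz : `|h%:C * z| <= `|h|%:C by rewrite normrM hE ler_piMr ?(ltW z1)// ler0c.
  have := hr (h%:C * z); rewrite mul0r subr0 -mulrDl -rmorphD /= => H.
  rewrite (le_trans (H _))//; first by rewrite (le_lt_trans hz)// rR ltcR.
  by rewrite rmorphM /= ler_wpM2l// ltW.
have Rez : complex.Re (g z) = complex.Re (g 0).
  have -> : z = 1%:C * z by rewrite mul1r.
  have -> : 0 = 0%:C * z by rewrite mul0r.
  apply: (@zero_derive_segment (fun t => complex.Re (g (t%:C * z)))) => t t0 t1 e e0.
  have [r r0 hr] := gt0 t e t0 t1 e0; exists r => // h /hr H.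
  by rewrite mul0r subr0 -raddfB -lecR (le_trans (normc_ge_Re _)).
have Imz : complex.Im (g z) = complex.Im (g 0).
  have -> : z = 1%:C * z by rewrite mul1r.
  have -> : 0 = 0%:C * z by rewrite mul0r.
  apply: (@zero_derive_segment (fun t => complex.Im (g (t%:C * z)))) => t t0 t1 e e0.
  have [r r0 hr] := gt0 t e t0 t1 e0; exists r => // h /hr H.
  by rewrite mul0r subr0 -raddfB -lecR (le_trans (normc_ge_Im _)).
by move: (g z) (g 0) Rez Imz => [? ?] [? ?] /= -> ->.
Qed.

Lemma psum0 b : psum b 0 = b 0%N.
Proof.
apply: psum_eq; apply: cvg_near_cst; exists 1%N => // -[//|N] _.
rewrite /series /= big_nat_recl//= expr0 mulr1 big1 ?addr0// => k _.
by rewrite expr0n mulr0.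
Qed.

(** Coefficients of the primitive that takes the value [c] at 0. *)
Definition antid (c : R[i]) d (k : nat) : R[i] :=
  if k is j.+1 then d j / j.+1%:R else c.

Lemma shiftd_antid c d : shiftd (antid c d) = d.
Proof. by apply/funext => k; rewrite /shiftd /= mulrC divfK// pnatr_eq0. Qed.

Lemma tame_antid c d : tame d -> tame (antid c d).
Proof.
move=> td r r0 r1; have [M HM] := td r r0 r1.
have M0 : 0 <= M by apply: le_trans (HM 0%N); rewrite big_ord0.
exists (`|c| + M) => -[|N]; first by rewrite big_ord0 addr_ge0.
rewrite big_ord_recl /= expr0 mulr1 lerD2l (le_trans _ (HM N))//.
apply: ler_sum => k _; rewrite /bump /= add1n normrM exprS normfV normr_nat.
rewrite -mulrA ler_wpM2l//.
rewrite (le_trans (ler_piMl _ _))//; first by rewrite mulr_ge0 ?exprn_ge0.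
  by rewrite invf_le1 ?ltr0n// ler1n.
by rewrite ler_piMl ?exprn_ge0// ltW.
Qed.

(** The difference from the integrated series has zero derivative and vanishes at 0. *)
Lemma psum_antid f d : tame d ->
  (forall x, unit_disk x -> cder f x (psum d x)) ->
  forall z, unit_disk z -> f z = psum (antid (f 0) d) z.
Proof.
move=> td fd z z1.
have := @zero_cder_disk (fun x => f x - psum (antid (f 0) d) x) z.
rewrite psum0 /= subrr => H; apply/eqP; rewrite -subr_eq0; apply/eqP; apply: H => //.
move=> x x1.
apply: cder_eq (cderB (fd _ x1) (psum_cder (tame_antid (f 0) td) x1)) _.
by rewrite shiftd_antid subrr.
Qed.

(** Taking one derivative first moves the claim from [b] to [shiftd b]; agreement on the disk
    suffices because differentiation is local. *)
Lemma derive1n_psum k f b : tame b -> (forall x, unit_disk x -> f x = psum b x) ->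
  derive1n k (f : R[i] -> R[i]^o) 0 = k`!%:R * b k.
Proof.
elim: k f b => [|k IH] f b tb fE.
  by rewrite derive1n0 mul1r fE ?psum0//; exact: unit_disk0.
rewrite derive1Sn (IH _ (shiftd b)).
- by rewrite /shiftd factS natrM; ring.
- exact: tame_shiftd.
move=> x x1; apply: (cderiveE (f := f)).
by apply: (cder_disk _ x1 (psum_cder tb x1)) => y y1; rewrite fE.
Qed.

Lemma taylor_coef_psum k f b : tame b ->
  (forall x, unit_disk x -> f x = psum b x) -> taylor_coef f k = b k.
Proof.
move=> tb fE; rewrite /taylor_coef (derive1n_psum k tb fE) mulrC mulKf//.
Qed.

End Taylor.

(** * Level curves of planar maps *)

(** Total differentiability with partial derivatives [a] and [b], measured on squares in the l1
    norm. *)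
Definition diff2 (R : realType) (U : R -> R -> R) (x y a b : R) : Prop :=
  forall e, 0 < e -> exists2 r, 0 < r & forall h k, `|h| < r -> `|k| < r ->
    `|U (x + h) (y + k) - U x y - (a * h + b * k)| <= e * (`|h| + `|k|).

Section LevelCurves.
Variable R : realType.

Lemma cder_near_le (f : R -> R) x d : cder f x d -> forall e, 0 < e ->
  exists2 r, 0 < r & forall h, `|h| < r -> `|f (x + h) - f x| < e.
Proof.
move=> /cder_lip[r r0 hr] e e0; have K0 : 0 < `|d| + 1 by rewrite ltr_wpDl.
exists (Num.min r (e / (`|d| + 1))); first by rewrite lt_min r0 divr_gt0.
move=> h; rewrite lt_min => /andP[/hr hh]; rewrite ltr_pdivlMr// => h2.
by rewrite (le_lt_trans hh)// mulrC.
Qed.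

Lemma cder_continuous (f df : R -> R) :
  (forall x, cder f x (df x)) -> continuous f.
Proof.
move=> fd x; apply: differentiable_continuous; apply/derivable1_diffP.
by have /rderP[] := fd x.
Qed.

Lemma cder_mean (f df : R -> R) x y : (forall x, cder f x (df x)) -> x <= y ->
  exists c, f y - f x = df c * (y - x).
Proof.
move=> fd xy; have [|||c _ ->] := @MVT_segment R f df x y; last by exists c.
- by [].
- by move=> t _; apply/rderP.
- by apply: continuous_subspaceT; exact: cder_continuous fd.
Qed.

Lemma cder_incr (f df : R -> R) : (forall x, cder f x (df x)) ->
  (forall x, 0 < df x) -> {homo f : x y / x < y}.
Proof.
move=> fd df0 x y xy; have [c fc] := cder_mean fd (ltW xy).
by rewrite -subr_gt0 fc mulr_gt0// subr_gt0.
Qed.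

Lemma cder_ndecr (f df : R -> R) : (forall x, cder f x (df x)) ->
  (forall x, 0 <= df x) -> {homo f : x y / x <= y}.
Proof.
move=> fd df0 x y xy; have [c fc] := cder_mean fd xy.
by rewrite -subr_ge0 fc mulr_ge0// subr_ge0.
Qed.

Lemma homo_lt_mono (f : R -> R) : {homo f : x y / x < y} -> {mono f : x y / x < y}.
Proof. by move=> /le_mono/leW_mono. Qed.

Lemma homo_lt_inj (f : R -> R) : {homo f : x y / x < y} -> injective f.
Proof.
move=> fm x y fxy; have [xy|yx|//] := ltgtP x y.
  by have := fm _ _ xy; rewrite fxy ltxx.
by have := fm _ _ yx; rewrite fxy ltxx.
Qed.

Lemma cder_IVT (f df : R -> R) x y v : (forall x, cder f x (df x)) ->
  {homo f : x y / x < y} -> f x < v -> v < f y -> exists t, f t = v.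
Proof.
move=> fd fm xv vy; have xy : x <= y.
  by rewrite ltW// -(homo_lt_mono fm) (lt_trans xv).
have [|||t _ ft] := @IVT R f x y v; last by exists t.
- by [].
- by apply: continuous_subspaceT; exact: cder_continuous fd.
- by rewrite ge_min le_max (ltW xv) (ltW vy) orbT.
Qed.

Lemma diff2_x (U : R -> R -> R) x y a b : diff2 U x y a b -> cder (U^~ y) x a.
Proof.
move=> dU e /dU[r r0 hr]; exists r => // h hh.
by have := hr h 0 hh; rewrite normr0 => /(_ r0); rewrite !addr0 mulr0 addr0.
Qed.

Lemma diff2_y (U : R -> R -> R) x y a b : diff2 U x y a b -> cder (U x) y b.
Proof.
move=> dU e /dU[r r0 hr]; exists r => // h hh.
by have := hr 0 h; rewrite normr0 => /(_ r0 hh); rewrite addr0 mulr0 !add0r.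
Qed.

Variables (U V Ux Uy Vx Vy : R -> R -> R).
Hypothesis dU : forall x y, diff2 U x y (Ux x y) (Uy x y).
Hypothesis dV : forall x y, diff2 V x y (Vx x y) (Vy x y).
Hypothesis Vy_gt0 : forall x y, 0 < Vy x y.
Hypothesis jac_gt0 : forall x y, 0 < Ux x y * Vy x y - Uy x y * Vx x y.
Hypothesis V_unbounded : forall x M, (exists y, M < V x y) /\ (exists y, V x y < M).

Let V_y x y : cder (V x) y (Vy x y). Proof. exact: diff2_y (dV x y). Qed.

Let V_incr x : {homo V x : y y' / y < y'}.
Proof. exact: cder_incr (V_y x) (Vy_gt0 x). Qed.

Lemma level_exists x v : exists y, V x y = v.
Proof.
have [[y vy] _] := V_unbounded x v; have [_ [y' y'v]] := V_unbounded x v.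
exact: cder_IVT (V_y x) (@V_incr x) y'v vy.
Qed.

(** The level set V = v as a graph: its height over [x], unique because V increases in its second
    variable. *)
Let Y v x := projT1 (cid (level_exists x v)).

Let YE v x : V x (Y v x) = v. Proof. by rewrite /Y; case: cid. Qed.

Let Y_near (f : R -> R) (y e : R) : {homo f : x y / x < y} -> 0 < e ->
  forall t, f (y - e / 2) < f t -> f t < f (y + e / 2) -> `|t - y| < e.
Proof.
move=> /homo_lt_mono fm e0 t; rewrite !fm => h1 h2; rewrite ltr_norml; apply/andP; split; lra.
Qed.

(** Implicit differentiation: the graph V = v has slope -Vx/Vy. *)
Lemma level_cder v x (y := Y v x) :
  cder (fun x => U x (Y v x)) x (Ux x y - Uy x y * Vx x y / Vy x y).
Proof.
move=> e e0; rewrite -/y.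
have vy0 := Vy_gt0 x y.
(* Lipschitz constant of the graph near x: with error at most Vy/2, the differential of V gives Vy
   |k| <= |Vx| |h| + Vy/2 (|h| + |k|), which is solved for |k|. *)
pose K := (2 * `|Vx x y| + Vy x y) / Vy x y.
have K0 : 0 <= K by rewrite divr_ge0 ?addr_ge0 ?mulr_ge0// ltW.
have L0 : 0 < (1 + `|Uy x y| / Vy x y) * (1 + K).
  by rewrite mulr_gt0// ltr_wpDr// divr_ge0// ltW.
(* The first bound yields the constant [K]; the second brings the combined errors of U and V below e
   |h|. *)
pose e1 := Num.min (Vy x y / 2) (e / ((1 + `|Uy x y| / Vy x y) * (1 + K))).
have e10 : 0 < e1 by rewrite lt_min !divr_gt0.
have [r1 r10 h1] := dU x y e10.
have [r2 r20 h2] := dV x y e10.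
have [r [r0 rr1 rr2]] : exists r, [/\ 0 < r, r <= r1 & r <= r2].
  by exists (Num.min r1 r2); rewrite lt_min r10 !ge_min !lexx orbT.
(* The values of V at heights y - r/2 and y + r/2 straddle v at abscissa x, hence also at x + h for
   small h; this traps the graph within r of y. *)
have yl : V x (y - r / 2) < v by rewrite -[X in _ < X](YE v x) V_incr// -/y; lra.
have yr : v < V x (y + r / 2) by rewrite -[X in X < _](YE v x) V_incr// -/y; lra.
have [rl rl0 hl] := cder_near_le (diff2_x (dV x (y - r / 2))) (etrans (subr_gt0 _ _) yl).
have [rr rr0 hrr] := cder_near_le (diff2_x (dV x (y + r / 2))) (etrans (subr_gt0 _ _) yr).
exists (Num.min r (Num.min rl rr)); first by rewrite !lt_min r0 rl0.
move=> h; rewrite !lt_min => /andP[hr /andP[/hl hl' /hrr hr']].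
pose k := Y v (x + h) - y.
have kr : `|k| < r.
  apply: (Y_near (@V_incr (x + h))) => //; rewrite YE.
    by move: hl'; rewrite ltr_norml => /andP[_]; lra.
  by move: hr'; rewrite ltr_norml => /andP[]; lra.
have yk : Y v (x + h) = y + k by rewrite /k; ring.
have := h2 h k (lt_le_trans hr rr2) (lt_le_trans kr rr2).
have := h1 h k (lt_le_trans hr rr1) (lt_le_trans kr rr1).
have Vxy : V x y = v := YE v x.
rewrite -!yk YE Vxy subrr sub0r normrN.
set u := U _ _ - U x y - _ => uh vh.
have e1V : e1 <= Vy x y / 2 by rewrite ge_min lexx.
have e1e : e1 * ((1 + `|Uy x y| / Vy x y) * (1 + K)) <= e.
  by rewrite -ler_pdivlMr// ge_min lexx orbT.
have kK : `|k| <= K * `|h|.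
  rewrite /K mulrAC ler_pdivlMr//.
  have vk : `|Vy x y * k| <= `|Vx x y| * `|h| + e1 * (`|h| + `|k|).
    have -> : Vy x y * k = (Vx x y * h + Vy x y * k) - Vx x y * h by ring.
    by rewrite (le_trans (ler_normB _ _))// addrC lerD// normrM.
  rewrite normrM (gtr0_norm vy0) in vk.
  have : e1 * (`|h| + `|k|) <= Vy x y / 2 * (`|h| + `|k|) by rewrite ler_wpM2r// addr_ge0.
  nra.
(* V is constant along the graph, so Vx h + Vy k is pure error, and its multiple by Uy/Vy eliminates
   k from the main term. *)
have -> : U (x + h) (Y v (x + h)) - U x y - (Ux x y - Uy x y * Vx x y / Vy x y) * h =
  u + Uy x y / Vy x y * (Vx x y * h + Vy x y * k).
  by rewrite /u; field; rewrite gt_eqF.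
rewrite (le_trans (ler_normD _ _))//.
have hk : e1 * (`|h| + `|k|) <= e1 * ((1 + K) * `|h|).
  by rewrite ler_pM2l// mulrDl mul1r lerD2l.
have : `|Uy x y / Vy x y * (Vx x y * h + Vy x y * k)| <= `|Uy x y| / Vy x y * (e1 * (`|h| + `|k|)).
  by rewrite normrM normf_div (gtr0_norm vy0) ler_wpM2l// divr_ge0// ltW.
move=> w1; apply: le_trans (lerD uh w1) _.
apply: le_trans (ler_wpM2r (normr_ge0 h) e1e).
have q0 : 0 <= `|Uy x y| / Vy x y by rewrite divr_ge0// ltW.
have -> : e1 * ((1 + `|Uy x y| / Vy x y) * (1 + K)) * `|h| =
  e1 * ((1 + K) * `|h|) + `|Uy x y| / Vy x y * (e1 * ((1 + K) * `|h|)) by ring.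
by rewrite lerD// ler_wpM2l.
Qed.

Let W v x := U x (Y v x).

Let W_cder v x : cder (W v) x
  (Ux x (Y v x) - Uy x (Y v x) * Vx x (Y v x) / Vy x (Y v x)).
Proof. exact: level_cder. Qed.

(** Multiplied by Vy, the derivative of U along the level curve is the Jacobian. *)
Let W_incr v : {homo W v : x x' / x < x'}.
Proof.
apply: cder_incr (W_cder v) _ => x; set y := Y v x.
by rewrite -(pmulr_rgt0 _ (Vy_gt0 x y)) mulrBr mulrC [Vy x y * _]mulrC divfK ?gt_eqF.
Qed.

Let Y_uniq v x y : V x y = v -> Y v x = y.
Proof. by move=> Vxy; apply: (homo_lt_inj (@V_incr x)); rewrite YE. Qed.

(** Equal V puts both points on one level curve, where U is strictly increasing in x; then V
    determines y. *)
Lemma level_inj x y x' y' : U x y = U x' y' -> V x y = V x' y' ->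
  x = x' /\ y = y'.
Proof.
move=> Uxy Vxy.
have xx : x = x'.
  apply: (homo_lt_inj (@W_incr (V x y))).
  by rewrite /W (Y_uniq erefl) (Y_uniq (esym Vxy)).
split => //; apply: (homo_lt_inj (@V_incr x)).
by rewrite Vxy xx.
Qed.

(** The slice of the image at height v is the range of a single continuous function, which later
    gives its connectedness. *)
Lemma level_path v : exists w : R -> R, [/\ continuous w,
  (forall x y, V x y = v -> w x = U x y) & (forall x, exists y, V x y = v)].
Proof.
exists (W v); split; last by move=> x; exact: level_exists.
- exact: cder_continuous (W_cder v).
- by move=> x y /Y_uniq <-.
Qed.

Let W_near_v x v0 : forall e : R, 0 < e -> exists2 r, 0 < r & forall v : R,
  `|v - v0| < r -> `|W v x - W v0 x| < e.
Proof.
move=> e e0; set y := Y v0 x.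
have [s s0 hs] := cder_near_le (diff2_y (dU x y)) e0.
have lo : V x (y - s / 2) < v0 by rewrite -[X in _ < X](YE v0 x) V_incr// -/y; lra.
have hi : v0 < V x (y + s / 2) by rewrite -[X in X < _](YE v0 x) V_incr// -/y; lra.
exists (Num.min (v0 - V x (y - s / 2)) (V x (y + s / 2) - v0)).
  by rewrite lt_min !subr_gt0 lo hi.
move=> v; rewrite lt_min => /andP[]; rewrite !ltr_norml => /andP[v1 _] /andP[_ v2].
rewrite -ltr_norml.
have : `|Y v x - y| < s by apply: (Y_near (@V_incr x)) => //; rewrite YE; lra.
by move=> /hs; rewrite [y + _]addrC subrK.
Qed.

(** On the level through the base point, U at abscissas x0 - 1 and x0 + 1 straddles its central
    value. Nearby levels change these two values little, so the intermediate value theorem along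
    each of them reaches every nearby [a]. *)
Lemma level_open x0 y0 : exists2 e, 0 < e & forall a b,
  `|a - U x0 y0| < e -> `|b - V x0 y0| < e -> exists x y, U x y = a /\ V x y = b.
Proof.
set v0 := V x0 y0.
have W0 : W v0 x0 = U x0 y0 by rewrite /W (Y_uniq erefl).
have l1 : W v0 (x0 - 1) < W v0 x0 by rewrite W_incr// gtrBl.
have l2 : W v0 x0 < W v0 (x0 + 1) by rewrite W_incr// ltrDl.
pose d := Num.min (W v0 x0 - W v0 (x0 - 1)) (W v0 (x0 + 1) - W v0 x0) / 2.
have d0 : 0 < d by rewrite divr_gt0// lt_min !subr_gt0 l1 l2.
have d1 : 2 * d <= W v0 x0 - W v0 (x0 - 1) by rewrite /d mulrC divfK// ge_min lexx.
have d2 : 2 * d <= W v0 (x0 + 1) - W v0 x0 by rewrite /d mulrC divfK// ge_min lexx orbT.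
have [r1 r10 h1] := W_near_v (x0 - 1) v0 d0.
have [r2 r20 h2] := W_near_v (x0 + 1) v0 d0.
exists (Num.min d (Num.min r1 r2)); first by rewrite !lt_min d0 r10.
move=> a b; rewrite !lt_min => /andP[ad _] /andP[_ /andP[/h1 b1 /h2 b2]].
move: ad b1 b2; rewrite -W0 !ltr_norml => /andP[a1 a2] /andP[b11 b12] /andP[b21 b22].
have [||x Wx] := @cder_IVT (W b) _ (x0 - 1) (x0 + 1) a (W_cder b) (@W_incr b).
- lra.
- lra.
- by exists x, (Y b x); rewrite YE.
Qed.

End LevelCurves.

(** * Differentials of complex-valued maps of two real variables *)

Definition cdiff2 (R : realType) (Psi : R -> R -> R[i]) (x y : R) (a b : R[i]) : Prop :=
  forall e : R, 0 < e -> exists2 r : R, 0 < r & forall h k : R, `|h| < r -> `|k| < r ->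
    `|Psi (x + h) (y + k) - Psi x y - (a * h%:C + b * k%:C)| <= (e * (`|h| + `|k|))%:C.

Section PlanarDifferential.
Variable R : realType.
Implicit Types (Psi Phi : R -> R -> R[i]) (x y : R) (a b : R[i]).

Lemma normcR (x : R) : `|x%:C| = `|x|%:C.
Proof. by rewrite normc_def /= expr0n addr0 sqrtr_sqr. Qed.

Lemma norm_RRe (z : R[i]) : `|z| = (complex.Re `|z|)%:C.
Proof. by rewrite RRe_real. Qed.

Lemma Re_norm_ge0 (z : R[i]) : 0 <= complex.Re `|z|.
Proof. by rewrite -ler0c -norm_RRe. Qed.

Lemma cdiff2_eq Psi x y a b a' b' :
  cdiff2 Psi x y a b -> a = a' -> b = b' -> cdiff2 Psi x y a' b'.
Proof. by move=> + <- <-. Qed.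

Lemma cdiff2_lip Psi x y a b : cdiff2 Psi x y a b ->
  exists r K, [/\ 0 < r, 0 < K & forall h k, `|h| < r -> `|k| < r ->
    `|Psi (x + h) (y + k) - Psi x y| <= (K * (`|h| + `|k|))%:C].
Proof.
move=> /(_ 1 ltr01)[r r0 hr]; pose A := complex.Re `|a|; pose B := complex.Re `|b|.
have A0 : 0 <= A by exact: Re_norm_ge0.
have B0 : 0 <= B by exact: Re_norm_ge0.
exists r, (1 + A + B); split => //; first by rewrite -addrA ltr_wpDr ?addr_ge0.
move=> h k /hr{}hr /hr{}hr.
rewrite -[X in `|X|](subrK (a * h%:C + b * k%:C)).
rewrite (le_trans (ler_normD _ _))// (le_trans (lerD hr (ler_normD _ _)))//.
rewrite !normrM !normcR (norm_RRe a) (norm_RRe b) -/A -/B -!rmorphM -!rmorphD lecR.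
have := normr_ge0 h; have := normr_ge0 k; nra.
Qed.

Lemma cdiff2_comp f d Psi x y a b : cder f (Psi x y) d -> cdiff2 Psi x y a b ->
  cdiff2 (fun x y => f (Psi x y)) x y (d * a) (d * b).
Proof.
move=> fd dPsi e e0.
have [r1 [K [r10 K0 lip]]] := cdiff2_lip dPsi.
pose D := complex.Re `|d|; have D0 : 0 <= D by exact: Re_norm_ge0.
have D10 : 0 < D + 1 by rewrite ltr_wpDl.
have [r2 r20 h2] := dPsi (e / 2 / (D + 1)) ltac:(by rewrite !divr_gt0).
have e10 : 0 < (e / 2 / K)%:C by rewrite ltcR !divr_gt0.
have [r3 r30 h3] := fd _ e10.
have r3E : r3 = (complex.Re r3)%:C by rewrite RRe_real // gtr0_real.
rewrite r3E ltcR in r30; rewrite r3E in h3.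
set s := complex.Re r3 in r30 h3 *.
(* The last radius forces K (|h| + |k|) < s, so the increment of [Psi] stays where [f] is
   controlled. *)
exists (Num.min (Num.min r1 r2) (s / (2 * K))).
  by rewrite !lt_min r10 r20 divr_gt0// mulr_gt0.
move=> h k; rewrite !lt_min => /andP[/andP[hr1 hr2] hs] /andP[/andP[kr1 kr2] ks].
have lhk := lip h k hr1 kr1; have dhk := h2 h k hr2 kr2.
have ls : K * (`|h| + `|k|) < s.
  by move: hs ks; rewrite !ltr_pdivlMr ?mulr_gt0//; nra.
have := h3 (Psi (x + h) (y + k) - Psi x y).
rewrite subrKC => /(_ (le_lt_trans lhk _)); rewrite ltcR => /(_ ls) fhk.
have -> : f (Psi (x + h) (y + k)) - f (Psi x y) - (d * a * h%:C + d * b * k%:C) =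
  (f (Psi (x + h) (y + k)) - f (Psi x y) - d * (Psi (x + h) (y + k) - Psi x y)) +
  d * (Psi (x + h) (y + k) - Psi x y - (a * h%:C + b * k%:C)) by ring.
rewrite (le_trans (ler_normD _ _))// (le_trans (lerD fhk _ : _ <= _ + (D * (e / 2 / (D + 1) * (`|h| + `|k|)))%:C))//.
  by rewrite normrM rmorphM /= (norm_RRe d) ler_wpM2l// -norm_RRe.
have fl : (e / 2 / K)%:C * `|Psi (x + h) (y + k) - Psi x y| <= (e / 2 / K * (K * (`|h| + `|k|)))%:C.
  by rewrite [leRHS]rmorphM /= ler_wpM2l// ltW.
rewrite (le_trans (lerD fl (lexx _)))// -rmorphD lecR.
rewrite mulrA divfK ?gt_eqF// mulrA -mulrDl ler_wpM2r ?addr_ge0//.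
rewrite [leRHS]splitr lerD2l mulrC mulrAC ler_pdivrMr//.
by rewrite mulrDr mulr1 lerDl divr_ge0// ltW.
Qed.

Lemma cdiff2D Psi Phi x y a b a' b' : cdiff2 Psi x y a b -> cdiff2 Phi x y a' b' ->
  cdiff2 (fun x y => Psi x y + Phi x y) x y (a + a') (b + b').
Proof.
move=> d1 d2 e e0; have e20 : 0 < e / 2 by rewrite divr_gt0.
have [r1 r10 h1] := d1 _ e20; have [r2 r20 h2] := d2 _ e20.
exists (Num.min r1 r2); first by rewrite lt_min r10.
move=> h k; rewrite !lt_min => /andP[hr1 hr2] /andP[kr1 kr2].
have := h1 h k hr1 kr1; have := h2 h k hr2 kr2 => n2 n1.
rewrite [X in `|X|](_ : _ = (Psi (x + h) (y + k) - Psi x y - (a * h%:C + b * k%:C)) +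
  (Phi (x + h) (y + k) - Phi x y - (a' * h%:C + b' * k%:C))); last by ring.
rewrite (le_trans (ler_normD _ _))// (le_trans (lerD n1 n2))// -rmorphD lecR.
by rewrite -mulrDl -splitr.
Qed.

Lemma cdiff2_fst (phi : R -> R) x y d : cder phi x d ->
  cdiff2 (fun x _ => (phi x)%:C) x y d%:C 0.
Proof.
move=> dphi e e0; have [r r0 hr] := dphi e e0; exists r => // h k /hr hh _.
rewrite mul0r addr0 -rmorphM -!rmorphB normcR lecR (le_trans hh)//.
by rewrite ler_pM2l// lerDl.
Qed.

Lemma cdiff2_snd (phi : R -> R) x y d : cder phi y d ->
  cdiff2 (fun _ y => (phi y)%:C) x y 0 d%:C.
Proof.
move=> dphi e e0; have [r r0 hr] := dphi e e0; exists r => // h k _ /hr hh.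
rewrite mul0r add0r -rmorphM -!rmorphB normcR lecR (le_trans hh)//.
by rewrite ler_pM2l// lerDr.
Qed.

Lemma cdiff2Z c Psi x y a b : cdiff2 Psi x y a b ->
  cdiff2 (fun x y => c * Psi x y) x y (c * a) (c * b).
Proof.
apply: (@cdiff2_comp (fun z => c * z)).
by apply: cder_eq (cderZ c (cder_id _)) _; exact: mulr1.
Qed.

(* Polarisation: p q = ((p + q)^2 - (p - q)^2) / 4. *)
Lemma cdiff2M Psi Phi x y a b a' b' : cdiff2 Psi x y a b -> cdiff2 Phi x y a' b' ->
  cdiff2 (fun x y => Psi x y * Phi x y) x y
    (Psi x y * a' + Phi x y * a) (Psi x y * b' + Phi x y * b).
Proof.
move=> d1 d2.
have sq Xi c c' : cdiff2 Xi x y c c' ->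
    cdiff2 (fun x y => 4^-1 * Xi x y ^+ 2) x y (2^-1 * Xi x y * c) (2^-1 * Xi x y * c').
  apply: (@cdiff2_comp (fun z => 4^-1 * z ^+ 2)).
  by apply: cder_eq (cderZ _ (cderX 2 (cder_id _))) _; rewrite /= expr1; field.
have := cdiff2D (sq _ _ _ (cdiff2D d1 d2)) (cdiff2Z (- 1) (sq _ _ _ (cdiff2D d1 (cdiff2Z (- 1) d2)))).
have -> : (fun x0 y0 => 4^-1 * (Psi x0 y0 + Phi x0 y0) ^+ 2 + -1 * (4^-1 * (Psi x0 y0 + -1 * Phi x0 y0) ^+ 2))
  = (fun x y => Psi x y * Phi x y) by apply/funext => s; apply/funext => t; field.
by move=> /cdiff2_eq; apply; field.
Qed.

Lemma cdiff2_Re Psi x y a b : cdiff2 Psi x y a b ->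
  diff2 (fun x y => complex.Re (Psi x y)) x y (complex.Re a) (complex.Re b).
Proof.
move=> d e e0; have [r r0 hr] := d e e0; exists r => // h k hh kk.
have := hr h k hh kk; rewrite -lecR; apply: le_trans.
have -> : complex.Re (Psi (x + h) (y + k)) - complex.Re (Psi x y) - (complex.Re a * h + complex.Re b * k) =
  complex.Re (Psi (x + h) (y + k) - Psi x y - (a * h%:C + b * k%:C)).
  by case: a {d hr} => ? ?; case: b => ? ?; case: (Psi _ _) => ? ?; case: (Psi _ _) => ? ? /=; ring.
exact: normc_ge_Re.
Qed.

Lemma cdiff2_Im Psi x y a b : cdiff2 Psi x y a b ->
  diff2 (fun x y => complex.Im (Psi x y)) x y (complex.Im a) (complex.Im b).
Proof.
move=> d e e0; have [r r0 hr] := d e e0; exists r => // h k hh kk.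
have := hr h k hh kk; rewrite -lecR; apply: le_trans.
have -> : complex.Im (Psi (x + h) (y + k)) - complex.Im (Psi x y) - (complex.Im a * h + complex.Im b * k) =
  complex.Im (Psi (x + h) (y + k) - Psi x y - (a * h%:C + b * k%:C)).
  by case: a {d hr} => ? ?; case: b => ? ?; case: (Psi _ _) => ? ?; case: (Psi _ _) => ? ? /=; ring.
exact: normc_ge_Im.
Qed.

End PlanarDifferential.

(** * Foliations of the disk *)

Definition quad (R : realType) (C : R) (z : R[i]) : R[i] := 1 + 2 * C%:C * z + z ^+ 2.

(* The leaves y |-> Psi x y are integral curves, up to a positive change of
   speed, of the field i * quad C; a and b are the partial derivatives of Psi. *)
Definition disk_chart (R : realType) (C : R) (Psi a b : R -> R -> R[i]) : Prop :=
  [/\ forall x y, unit_disk (Psi x y),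
      forall z, unit_disk z -> exists x y, Psi x y = z,
      forall x y, cdiff2 Psi x y (a x y) (b x y),
      forall x y, 0 < complex.Im ((a x y)^* * b x y) &
      (forall x y, exists2 lam, 0 < lam & b x y = 'i%C * lam%:C * quad C (Psi x y)) /\
      (forall x M,
        (exists2 y, 0 <= y & M < complex.Im (Psi x y / quad C (Psi x y))) /\
        (exists2 y, y <= 0 & complex.Im (Psi x y / quad C (Psi x y)) < M))].

Section Charts.
Variable R : realType.
Implicit Types (C x y : R) (z w t : R[i]).

(** The squared modulus as a real number turns inequalities between moduli into real polynomial
    ones. *)
Definition nsq z : R := complex.Re z ^+ 2 + complex.Im z ^+ 2.

Lemma nsqE z : `|z| ^+ 2 = (nsq z)%:C. Proof. by rewrite -add_Re2_Im2. Qed.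

Lemma norm_lt_nsq z w : (`|z| < `|w|) = (nsq z < nsq w).
Proof. by rewrite -(ltr_pXn2r (n := 2)) ?nnegrE// !nsqE ltcR. Qed.

Lemma unit_diskE z : unit_disk z <-> nsq z < 1.
Proof.
rewrite /unit_disk /= -[X in `|z| < X](@normr1 (R[i])) norm_lt_nsq.
by rewrite /nsq /= expr1n expr0n addr0.
Qed.

Lemma nsq_gt0 z : (0 < nsq z) = (z != 0).
Proof.
rewrite /nsq lt0r addr_ge0 ?sqr_ge0// andbT paddr_eq0 ?sqr_ge0// !sqrf_eq0.
by rewrite eq_complex.
Qed.

Lemma Re_inv z : complex.Re z^-1 = complex.Re z / nsq z.
Proof. by case: z. Qed.

(** Transports coordinates of the right half-plane to the disk by a conformal map [g] with
    derivative [m] and right inverse [ginv]. Orientation survives because the Jacobian is multiplied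
    by |m|^2. *)
Lemma mobius_chart C (tau p q : R -> R -> R[i]) (g m ginv : R[i] -> R[i]) :
  (forall x y, 0 < complex.Re (tau x y)) ->
  (forall t, 0 < complex.Re t -> exists x y, tau x y = t) ->
  (forall x y, cdiff2 tau x y (p x y) (q x y)) ->
  (forall x y, 0 < complex.Im ((p x y)^* * q x y)) ->
  (forall t, 0 < complex.Re t -> [/\ unit_disk (g t), cder g t (m t) & m t != 0]) ->
  (forall z, unit_disk z -> 0 < complex.Re (ginv z) /\ g (ginv z) = z) ->
  (forall x y, exists2 lam, 0 < lam &
     m (tau x y) * q x y = 'i%C * lam%:C * quad C (g (tau x y))) ->
  (forall x M,
     (exists2 y, 0 <= y & M < complex.Im (g (tau x y) / quad C (g (tau x y)))) /\
     (exists2 y, y <= 0 & complex.Im (g (tau x y) / quad C (g (tau x y))) < M)) ->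
  disk_chart C (fun x y => g (tau x y)) (fun x y => m (tau x y) * p x y)
    (fun x y => m (tau x y) * q x y).
Proof.
move=> t0 ts dt o gD gs fl un; split => //.
- by move=> x y; have [] := gD _ (t0 x y).
- move=> z /gs[/ts[x [y txy]] gz]; exists x, y; by rewrite txy.
- by move=> x y; apply: cdiff2_comp => //; have [] := gD _ (t0 x y).
- move=> x y; have [_ _] := gD _ (t0 x y); rewrite -nsq_gt0 => m0.
  have -> : (m (tau x y) * p x y)^* * (m (tau x y) * q x y) =
    (nsq (m (tau x y)))%:C * ((p x y)^* * q x y).
    by rewrite -nsqE sqr_normc rmorphM /=; ring.
  have := o x y; move: (_ * q x y) => [u v] /= v0.
  by rewrite mul0r addr0 mulr_gt0.
Qed.

(* The Cayley-type maps below turn the integral curves of i * quad C into rays from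
   the origin when -1 < C < 1, and into vertical lines when C = 1 or C = -1. *)
Lemma halfplane_rays : exists2 tau : R -> R -> R[i],
  (forall x y, tau x y = (expR (- y))%:C * (1 + 'i%C * x%:C)) &
  [/\ forall x y, 0 < complex.Re (tau x y),
      forall t, 0 < complex.Re t -> exists x y, tau x y = t,
      forall x y, cdiff2 tau x y ('i%C * (expR (- y))%:C) (- tau x y) &
      forall x y, 0 < complex.Im (('i%C * (expR (- y))%:C)^* * (- tau x y))].
Proof.
pose tau x y := (expR (- y))%:C * (1 + 'i%C * x%:C); exists tau => //; split.
- move=> x y; rewrite /tau /=; have := expR_gt0 (- y); nra.
- move=> [t1 t2] /= t0; exists (t2 / t1), (- ln t1).
  rewrite /tau opprK lnK ?posrE//; apply/eqP; rewrite eq_complex /=.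
  by apply/andP; split; apply/eqP; field; rewrite gt_eqF.
- move=> x y.
  have d1 : cder (fun y => expR (- y)) y (- expR (- y)).
    apply/rderP; apply: is_derive_eq.
    by rewrite /GRing.scale /=; ring.
  have d2 : cdiff2 (fun x _ : R => 1 + 'i%C * x%:C) x y 'i%C 0.
    have d0 : cdiff2 (fun x _ : R => (id x)%:C) x y 1 0 := cdiff2_fst _ (cder_id _).
    apply: cdiff2_eq (@cdiff2_comp _ (fun z => 1 + 'i%C * z) 'i%C _ _ _ _ _ _ d0) _ _.
    - apply: cder_eq (cderD (cder_cst _ _) (cderZ _ (cder_id _))) _.
      by rewrite mulr1 add0r.
    - by rewrite mulr1.
    - by rewrite mulr0.
  have := cdiff2M (cdiff2_snd x d1) d2.
  move=> /cdiff2_eq; apply; rewrite /tau; [|rewrite rmorphN]; ring.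
- move=> x y; rewrite /tau /=; have := expR_gt0 (- y); nra.
Qed.

(** The sign in the second coordinate directs the leaves along i times [quad]; the one in the first
    restores positive orientation. *)
Lemma halfplane_lines (eps : R) : eps ^+ 2 = 1 ->
  exists2 tau : R -> R -> R[i],
  (forall x y, tau x y = (expR (- (eps * x)))%:C - 'i%C * (eps * y)%:C) &
  [/\ forall x y, 0 < complex.Re (tau x y),
      forall t, 0 < complex.Re t -> exists x y, tau x y = t,
      forall x y, cdiff2 tau x y (- (eps * expR (- (eps * x))))%:C (- 'i%C * eps%:C) &
      forall x y, 0 < complex.Im (((- (eps * expR (- (eps * x))))%:C)^* * (- 'i%C * eps%:C))].
Proof.
move=> e1; pose tau x y := (expR (- (eps * x)))%:C - 'i%C * (eps * y)%:C.
exists tau => //; split.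
- move=> x y; rewrite /tau /=; have := expR_gt0 (- (eps * x)); nra.
- move=> [t1 t2] /= t0; exists (- (eps * ln t1)), (- (eps * t2)).
  rewrite /tau !mulrN !mulrA -expr2 e1 !mul1r opprK lnK ?posrE//.
  by apply/eqP; rewrite eq_complex /=; apply/andP; split; apply/eqP; ring.
- move=> x y.
  have d1 : cder (fun x => expR (- (eps * x))) x (- (eps * expR (- (eps * x)))).
    apply/rderP; apply: is_derive_eq.
    by rewrite /GRing.scale /=; ring.
  have d2 : cdiff2 (fun _ y : R => (eps * y)%:C) x y 0 eps%:C.
    by apply: (cdiff2_snd (phi := fun y => eps * y)); apply: cder_eq (cderZ _ (cder_id _)) _; rewrite mulr1.
  have := cdiff2D (cdiff2_fst y d1) (cdiff2Z (- 'i%C) d2).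
  have -> : (fun x y : R => (expR (- (eps * x)))%:C + - 'i%C * (eps * y)%:C) = tau.
    by apply/funext => s; apply/funext => t; rewrite /tau mulNr.
  by move=> /cdiff2_eq; apply; ring.
- move=> x y; rewrite /=; have := expR_gt0 (- (eps * x)); nra.
Qed.

End Charts.

(** * Charts for every C between -1 and 1 *)

Section ChartsExist.
Variable R : realType.
Implicit Types (C x y : R) (z w t : R[i]).

Lemma nsq_mul z w : nsq (z * w) = nsq z * nsq w.
Proof. by apply: (@complexI R); rewrite -nsqE normrM exprMn !nsqE rmorphM. Qed.

Lemma unit_disk_div z w : nsq z < nsq w -> unit_disk (z / w).
Proof.
move=> zw; have w0 : 0 < nsq w by rewrite (le_lt_trans _ zw)// addr_ge0 ?sqr_ge0.
have wn0 : w != 0 by rewrite -nsq_gt0.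
by rewrite /unit_disk /= normrM normfV ltr_pdivrMr ?normr_gt0// mul1r norm_lt_nsq.
Qed.

Lemma Re_gt0_neq0 z : 0 < complex.Re z -> z != 0.
Proof. by move=> h; rewrite -nsq_gt0 /nsq ltr_pwDl ?exprn_gt0 ?sqr_ge0. Qed.

Lemma cder_mobius (p q r s t : R[i]) : r * t + s != 0 ->
  cder (fun z => (p * z + q) / (r * z + s)) t ((p * s - q * r) / (r * t + s) ^+ 2).
Proof.
move=> d0.
have dl u v : cder (fun z => u * z + v) t u.
  by apply: cder_eq (cderD (cderZ u (cder_id t)) (cder_cst v t)) _; rewrite mulr1 addr0.
have := cderM (dl p q) (@cderV _ (fun z => r * z + s) _ _ d0 (dl r s)).
by move=> /cder_eq; apply; field.
Qed.

Lemma Re_divc z w : complex.Re (z / w) = complex.Re (z * w^*) / nsq w.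
Proof. by case: z => z1 z2; case: w => w1 w2; rewrite /nsq /=; ring. Qed.

Lemma Im_Rmul (r : R) z : complex.Im (r%:C * z) = r * complex.Im z.
Proof. by case: z => z1 z2 /=; ring. Qed.

(** Here [quad] is the square (1 + eps z)^2. The Cayley map sends infinity to its double zero -eps,
    and vertical lines become circles tangent to the boundary there. *)
Lemma chart_degenerate (eps : R) : eps ^+ 2 = 1 ->
  exists Psi a b, disk_chart eps Psi a b.
Proof.
move=> e1; have [tau tauE [t0 ts dt o]] := halfplane_lines e1.
pose e := eps%:C; have ee : e * e = 1 by rewrite -rmorphM -expr2 e1.
have e0 : e != 0 by apply/eqP => e0; move: ee; rewrite e0 mul0r => /esym/eqP; rewrite oner_eq0.
have ne1 : nsq e = 1 by rewrite /nsq /= expr0n addr0.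
pose g t := e * (1 - t) / (t + 1).
pose m t := - (2 * e) / (t + 1) ^+ 2.
pose ginv z := (1 - e * z) / (1 + e * z).
have den t : 0 < complex.Re t -> t + 1 != 0.
  by move=> h; apply: Re_gt0_neq0; rewrite raddfD /= addr_gt0.
have qE t : 0 < complex.Re t -> quad eps (g t) = 4 / (t + 1) ^+ 2.
  move=> h; rewrite /quad /g -/e.
  (* The product e * e stays symbolic so that [field] applies before e * e = 1 is used. *)
  have -> : 1 + 2 * e * (e * (1 - t) / (t + 1)) + (e * (1 - t) / (t + 1)) ^+ 2 =
    ((t + 1) ^+ 2 + 2 * (e * e) * (1 - t) * (t + 1) + (e * e) * (1 - t) ^+ 2) / (t + 1) ^+ 2.
    by field; exact: den.
  by rewrite ee; congr (_ / _); ring.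
exists (fun x y => g (tau x y)).
exists (fun x y => m (tau x y) * (- (eps * expR (- (eps * x))))%:C).
exists (fun x y => m (tau x y) * (- 'i%C * e)).
apply: (@mobius_chart _ eps tau _ _ g m ginv) => //.
- move=> t ht; split.
  + apply: unit_disk_div; rewrite nsq_mul ne1 mul1r.
    by case: t ht => t1 t2 /= ht; rewrite /nsq /=; lra.
  + have -> : g = fun z => ((- e) * z + e) / (1 * z + 1).
      by apply/funext => z; rewrite /g mul1r; congr (_ / _); ring.
    apply: cder_eq (cder_mobius _ _ _) _; first by rewrite mul1r den.
    by rewrite /m mul1r; congr (_ / _); ring.
  + by rewrite /m mulf_neq0// ?invr_eq0 ?expf_neq0 ?den// oppr_eq0 mulf_neq0// pnatr_eq0.
- move=> z /unit_diskE z1.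
  have z0 : 1 + e * z != 0.
    rewrite addrC; apply/eqP => /eqP; rewrite addr_eq0 => /eqP ez.
    have : nsq (e * z) = 1 by rewrite ez /nsq /=; ring.
    by rewrite nsq_mul ne1 mul1r => ez1; move: z1; rewrite ez1 ltxx.
  split.
    rewrite /ginv Re_divc divr_gt0 ?nsq_gt0//.
    have : nsq (e * z) < 1 by rewrite nsq_mul ne1 mul1r.
    by case: (e * z) => x y; rewrite /nsq /=; lra.
  rewrite /g /ginv.
  have -> : e * (1 - (1 - e * z) / (1 + e * z)) / ((1 - e * z) / (1 + e * z) + 1) = (e * e) * z.
    by field; rewrite z0 /= (_ : _ + _ = 2) ?pnatr_eq0//; ring.
  by rewrite ee mul1r.
- move=> x y; exists 2^-1; first by rewrite invr_gt0.
  rewrite (qE _ (t0 x y)) /m; rewrite fmorphV rmorph_nat; have dn := den _ (t0 x y).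
  have -> : - (2 * e) / (tau x y + 1) ^+ 2 * (- 'i%C * e) = (2 * (e * e)) * 'i%C / (tau x y + 1) ^+ 2.
    by field.
  by rewrite ee; field.
- move=> x M; have X0 := expR_gt0 (- (eps * x)); set X := expR _ in X0.
  (* On a leaf u/q equals eps (1 - t^2)/4, whose imaginary part is linear in y with slope X/2 >
     0. *)
  have E y : complex.Im (g (tau x y) / quad eps (g (tau x y))) = X * y / 2.
    rewrite (qE _ (t0 x y)); have -> : g (tau x y) / (4 / (tau x y + 1) ^+ 2) = (4^-1 : R)%:C * (e * (1 - tau x y ^+ 2)).
      by rewrite /g; rewrite fmorphV rmorph_nat; field; exact: den (t0 x y).
    rewrite !Im_Rmul tauE expr2 /= -/X.
    have -> : 4^-1 * (eps * (0 - ((X - (0 * (eps * y) - 1 * 0)) * (0 - (0 * 0 + 1 * (eps * y))) +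
      (0 - (0 * 0 + 1 * (eps * y))) * (X - (0 * (eps * y) - 1 * 0))))) = eps ^+ 2 * (X * y / 2) by field.
    by rewrite e1 mul1r.
  have M0 := normr_ge0 M; have M1 := ler_norm M; have M2 : - `|M| <= M by rewrite lerNl -normrN ler_norm.
  split; [exists (2 * (`|M| + 1) / X) | exists (- (2 * (`|M| + 1) / X))]; rewrite ?E.
  + by rewrite divr_ge0 ?mulr_ge0 ?addr_ge0// ltW.
  + rewrite (_ : X * (2 * (`|M| + 1) / X) / 2 = `|M| + 1); first lra.
    by field; rewrite gt_eqF.
  + by rewrite oppr_le0 divr_ge0 ?mulr_ge0 ?addr_ge0// ltW.
  + rewrite (_ : X * - (2 * (`|M| + 1) / X) / 2 = - (`|M| + 1)).
      lra.
    by field; rewrite gt_eqF.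
Qed.

(** With S^2 = 1 - C^2 and e = C + i S, the zeros of [quad] are -e and its conjugate, two distinct
    points of the unit circle. The map [g] sends infinity and 0 to them, so rays from the origin
    become arcs joining them. *)
Lemma chart_generic C : -1 < C -> C < 1 -> exists Psi a b, disk_chart C Psi a b.
Proof.
move=> C1 C2; have [tau tauE [t0 ts dt o]] := halfplane_rays R.
pose S := Num.sqrt (1 - C ^+ 2); have S20 : 0 < 1 - C ^+ 2 by nra.
have S2 : S ^+ 2 = 1 - C ^+ 2 by rewrite sqr_sqrtr// ltW.
have S0 : 0 < S by rewrite sqrtr_gt0.
pose e := C +i* S.
have ne1 : nsq e = 1 by rewrite /nsq /= S2; ring.
have ne0 : e != 0 by rewrite -nsq_gt0 ne1.
have e2 : e ^+ 2 = 2 * C%:C * e - 1.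
  by apply/eqP; rewrite eq_complex /=; apply/andP; split; apply/eqP; rewrite -?expr2 ?S2; ring.
have ii : 'i%C * 'i%C = -1 :> R[i] by rewrite -expr2 sqr_i.
have SC0 : S%:C != 0 by rewrite eq_complex /= eqxx andbT gt_eqF.
pose g t := ((- e) * t + 'i%C) / (t - 'i%C * e).
pose m t := ('i%C * (e ^+ 2 - 1)) / (t - 'i%C * e) ^+ 2.
pose ginv z := 'i%C * (1 + e * z) / (z + e).
have den t : 0 < complex.Re t -> t - 'i%C * e != 0.
  by move=> h; apply: Re_gt0_neq0; rewrite raddfB /=; lra.
have qE t : 0 < complex.Re t ->
    quad C (g t) = - 4 * 'i%C * S%:C ^+ 2 * e * t / (t - 'i%C * e) ^+ 2.
  move=> h; have dn := den _ h; rewrite /quad /g.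
  have -> : S%:C ^+ 2 = 1 - C%:C ^+ 2 by rewrite -!rmorphXn S2 rmorphB.
  (* The first summand displays the vanishing factor e^2 - (2 C e - 1), which makes the equation a
     formal identity for [field]. *)
  have -> : 1 + 2 * C%:C * ((- e * t + 'i%C) / (t - 'i%C * e)) + ((- e * t + 'i%C) / (t - 'i%C * e)) ^+ 2 =
    ((e ^+ 2 - (2 * C%:C * e - 1)) * (t ^+ 2 + 2 * C%:C * 'i%C * t + 'i%C ^+ 2)
     + - 4 * 'i%C * (1 - C%:C ^+ 2) * e * t) / (t - 'i%C * e) ^+ 2 by field.
  by rewrite e2 subrr mul0r add0r.
have e21 : e ^+ 2 - 1 = 2 * 'i%C * S%:C * e.
  apply/eqP; rewrite eq_complex /=; apply/andP; split; apply/eqP; rewrite -?expr2; last ring.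
  by move: S2; rewrite expr2; lra.
exists (fun x y => g (tau x y)).
exists (fun x y => m (tau x y) * ('i%C * (expR (- y))%:C)).
exists (fun x y => m (tau x y) * (- tau x y)).
apply: (@mobius_chart _ C tau _ _ g m ginv) => //.
- move=> t ht; split.
  + apply: unit_disk_div; move: ne1; rewrite /nsq /e.
    by case: t ht => t1 t2 /= ht h1; nra.
  + have -> : g = fun z => ((- e) * z + 'i%C) / (1 * z + (- ('i%C * e))).
      by apply/funext => z; rewrite /g mul1r.
    apply: cder_eq (cder_mobius _ _ _) _; first by rewrite mul1r den.
    rewrite /m mul1r; congr (_ / _); ring.
  + rewrite /m mulf_neq0// ?invr_eq0 ?expf_neq0 ?den// e21.
    by rewrite !mulf_neq0// ?pnatr_eq0// eq_complex /= oner_eq0 andbF.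
- move=> z /unit_diskE z1.
  have z0 : z + e != 0.
    apply/eqP => /eqP; rewrite addr_eq0 => /eqP ez.
    by move: z1; rewrite ez /nsq /= !sqrrN -/(nsq e) ne1 ltxx.
  split.
    rewrite /ginv Re_divc divr_gt0 ?nsq_gt0//.
    move: z1 ne1; rewrite /e; case: (z) => x y; rewrite /nsq /= => z1 h1.
    have : y * (C ^+ 2 + S ^+ 2 - 1) = 0 by rewrite h1 subrr mulr0.
    have : 0 < S * (1 - (x ^+ 2 + y ^+ 2)) by rewrite mulr_gt0// subr_gt0.
    lra.
  have -> : g (ginv z) = ('i%C * (1 - e ^+ 2) / (z + e) * z) / ('i%C * (1 - e ^+ 2) / (z + e)).
    by rewrite /g /ginv; congr (_ / _); field.
  rewrite mulrC mulKf// mulf_neq0 ?invr_eq0// mulf_neq0//.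
    by rewrite eq_complex /= oner_eq0 andbF.
  by rewrite -opprB e21 oppr_eq0 !mulf_neq0// ?pnatr_eq0// eq_complex /= oner_eq0 andbF.
- move=> x y; exists (2 * S)^-1; first by rewrite invr_gt0 mulr_gt0.
  have dn := den _ (t0 x y).
  rewrite (qE _ (t0 x y)) /m; rewrite fmorphV rmorphM rmorph_nat e21.
  have -> : 'i%C * (2 * 'i%C * S%:C * e) / (tau x y - 'i%C * e) ^+ 2 * - tau x y =
     ('i%C * 'i%C) * (- 2) * S%:C * e * tau x y / (tau x y - 'i%C * e) ^+ 2 by field.
  have -> : 'i%C * (2 * S%:C)^-1 * (- 4 * 'i%C * S%:C ^+ 2 * e * tau x y / (tau x y - 'i%C * e) ^+ 2) =
     ('i%C * 'i%C) * (- 2) * S%:C * e * tau x y / (tau x y - 'i%C * e) ^+ 2.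
    by field; rewrite dn SC0.
  by [].
- move=> x M.
  have S4 : 0 < 4 * S ^+ 2 by rewrite mulr_gt0// exprn_gt0.
  have X1 : 1 <= 1 + x ^+ 2 by rewrite lerDl sqr_ge0.
  have X0 : 0 < 1 + x ^+ 2 by rewrite (lt_le_trans _ X1).
  (* Up to a real additive constant, u/q is i (1/t - t)/(4 S^2), so only Re(1/t - t) is left to
     compute. *)
  have E y : complex.Im (g (tau x y) / quad C (g (tau x y))) =
      (4 * S ^+ 2)^-1 * (expR y / (1 + x ^+ 2) - expR (- y)).
    have dn := den _ (t0 x y); have tn := Re_gt0_neq0 (t0 x y).
    rewrite (qE _ (t0 x y)); set t := tau x y in dn tn *.
    have i0 : 'i%C != 0 :> R[i] by rewrite eq_complex /= oner_eq0 andbF.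
    have -> : g t / (- 4 * 'i%C * S%:C ^+ 2 * e * t / (t - 'i%C * e) ^+ 2) =
       'i%C * ((- e * t + 'i%C) * (t - 'i%C * e)) / (- 4 * ('i%C * 'i%C) * S%:C ^+ 2 * e * t).
      by rewrite /g; field; rewrite dn tn i0 ne0 SC0.
    have -> : (- e * t + 'i%C) * (t - 'i%C * e) =
       e * (- t ^+ 2) + 'i%C * (e ^+ 2 + 1) * t - ('i%C * 'i%C) * e by ring.
    rewrite ii e2.
    have -> : 'i%C * (e * - t ^+ 2 + 'i%C * (2 * C%:C * e - 1 + 1) * t - -1 * e) / (- 4 * -1 * S%:C ^+ 2 * e * t) =
      (4 * S%:C ^+ 2)^-1 * ('i%C * (t^-1 - t) + ('i%C * 'i%C) * (2 * C%:C)).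
      by field; rewrite tn ne0 SC0.
    have -> : (4 * S%:C ^+ 2)^-1 = ((4 * S ^+ 2)^-1)%:C by rewrite fmorphV rmorphM rmorph_nat rmorphXn.
    rewrite Im_Rmul ii; congr (_ * _).
    have -> : complex.Im ('i%C * (t^-1 - t) + -1 * (2 * C%:C)) = complex.Re (t^-1 - t).
      by case: (t^-1 - t) => u v /=; ring.
    rewrite (_ : complex.Re (t^-1 - t) = complex.Re t^-1 - complex.Re t); last first.
      by case: (t^-1) => u v; case: (t).
    rewrite Re_inv.
    have -> : nsq t = expR (- y) ^+ 2 * (1 + x ^+ 2) by rewrite /t tauE /nsq /=; ring.
    have -> : complex.Re t = expR (- y) by rewrite /t tauE /=; ring.
    have -> : expR y = (expR (- y))^-1 by rewrite -expRN opprK.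
    by field; rewrite !gt_eqF ?expR_gt0.
  have M0 := normr_ge0 M; have M1 := ler_norm M.
  have M2 : - `|M| <= M by rewrite lerNl -normrN ler_norm.
  have k0 : 0 <= 4 * S ^+ 2 * `|M| + 1 by rewrite addr_ge0// mulr_ge0// ltW.
  split.
    (* By e^y >= 1 + y the first term then exceeds 4 S^2 |M| + 1, while e^(-y) <= 1. *)
    exists ((1 + x ^+ 2) * (4 * S ^+ 2 * `|M| + 1)); first by rewrite mulr_ge0// ltW.
    set y := _ * _ : R; have y0 : 0 <= y by rewrite mulr_ge0// ltW.
    rewrite E (le_lt_trans M1)// mulrC ltr_pdivlMr//.
    have h1 : 4 * S ^+ 2 * `|M| + 1 < expR y / (1 + x ^+ 2).
      by rewrite ltr_pdivlMr// mulrC -/y (lt_le_trans _ (expR_ge1Dx y))// ltrDr.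
    have h2 : expR (- y) <= 1 by rewrite -expR0 ler_expR oppr_le0.
    lra.
  (* For negative y the roles are exchanged: the first term is at most 1, and e^(-y) is large. *)
  exists (- (4 * S ^+ 2 * `|M| + 1)); first by rewrite oppr_le0.
  set y := 4 * _ * _ + _ : R.
  rewrite E opprK (lt_le_trans _ M2)// mulrC ltr_pdivrMr//.
  have h1 : expR (- y) / (1 + x ^+ 2) <= 1.
    by rewrite ler_pdivrMr// mul1r (le_trans _ X1)// -expR0 ler_expR oppr_le0.
  have h2 := expR_ge1Dx y.
  rewrite /y in h1 h2 *; lra.
Qed.

Lemma chart_exists C : -1 <= C -> C <= 1 -> exists Psi a b, disk_chart C Psi a b.
Proof.
rewrite !le_eqVlt => /orP[/eqP <- _|C1 /orP[/eqP ->|C2]].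
- by apply: chart_degenerate; ring.
- by apply: chart_degenerate; ring.
- exact: chart_generic.
Qed.

End ChartsExist.

(** * The sheared map *)

Section Core.
Variable R : realType.
Implicit Types (C : R) (u z w : R[i]).

Lemma Re_cayley_gt0 z : unit_disk z -> 1 + z != 0 /\ 0 < complex.Re ((1 - z) / (1 + z)).
Proof.
move=> /unit_diskE z1.
have z0 : 1 + z != 0.
  apply/eqP => h; have {h}zE : z = -1 by rewrite -[z](addKr 1) h addr0.
  by move: z1; rewrite zE /nsq /= oppr0 expr0n addr0 sqrrN expr1n ltxx.
split=> //; rewrite Re_divc divr_gt0 ?nsq_gt0//.
by move: z1; case: (z) => x y; rewrite /nsq /=; lra.
Qed.

Lemma unit_diskM z w : unit_disk z -> nsq w = 1 -> unit_disk (z * w).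
Proof. by move=> /unit_diskE z1 w1; apply/unit_diskE; rewrite nsq_mul w1 mulr1. Qed.

(** With e + e' = 2C and e e' = 1, [quad] factors as (1 + u e)(1 + u e'), and the quotient is the
    mean of the two Cayley transforms of u e and u e'. *)
Lemma quad_facts C u : -1 <= C -> C <= 1 -> unit_disk u ->
  quad C u != 0 /\ 0 < complex.Re ((1 - u ^+ 2) / quad C u).
Proof.
move=> C1 C2 u1; have S2 : 0 <= 1 - C ^+ 2 by nra.
pose S := Num.sqrt (1 - C ^+ 2); have SS : S ^+ 2 = 1 - C ^+ 2 by rewrite sqr_sqrtr.
pose e := C +i* S; pose e' := C -i* S.
have ne : nsq e = 1 by rewrite /nsq /= SS; ring.
have ne' : nsq e' = 1 by rewrite /nsq /= sqrrN SS; ring.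
have ee : e * e' = 1.
  by apply/eqP; rewrite eq_complex /=; apply/andP; split; apply/eqP; move: SS; rewrite ?expr2; lra.
have es : e + e' = 2 * C%:C.
  by apply/eqP; rewrite eq_complex /=; apply/andP; split; apply/eqP; ring.
have [x0 xr] := Re_cayley_gt0 (unit_diskM u1 ne).
have [y0 yr] := Re_cayley_gt0 (unit_diskM u1 ne').
have qE : quad C u = (1 + u * e) * (1 + u * e').
  have -> : (1 + u * e) * (1 + u * e') = 1 + (e + e') * u + (e * e') * u ^+ 2 by ring.
  by rewrite /quad es ee; ring.
split; first by rewrite qE mulf_neq0.
have -> : (1 - u ^+ 2) / quad C u = (2^-1 : R)%:C * ((1 - u * e) / (1 + u * e) + (1 - u * e') / (1 + u * e')).
  have -> : 1 - u ^+ 2 = 1 - (e * e') * u ^+ 2 by rewrite ee mul1r.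
  by rewrite qE fmorphV rmorph_nat; field; rewrite x0 y0.
by move: xr yr; case: (_ / _) => a b; case: (_ / _) => a' b' /=; lra.
Qed.

(** Since 1 - m >= 0 and Re b > 0, the point b is at least as far from 1 - m as from -(1 - m); the
    factor |s| < 1 makes the inequality strict. *)
Lemma dilatation_bound (s g b : R[i]) (m : R) : nsq s < 1 -> g != 0 ->
  0 < complex.Re b -> m <= 1 ->
  nsq (s * g * (1 - m%:C - b)) < nsq (g * (1 - m%:C + b)).
Proof.
rewrite -nsq_gt0 => s1 g0 b0 m1; rewrite !nsq_mul mulrAC mulrC.
rewrite ltr_pM2l//; have s0 : 0 <= nsq s by rewrite addr_ge0 ?sqr_ge0.
have hle : nsq (1 - m%:C - b) <= nsq (1 - m%:C + b).
  by case: b b0 => x y /= x0; rewrite /nsq /=; nra.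
have hgt : 0 < nsq (1 - m%:C + b).
  rewrite nsq_gt0; apply: Re_gt0_neq0.
  by case: b b0 {hle} => x y /= x0; lra.
have h0 : 0 <= nsq (1 - m%:C - b) by rewrite addr_ge0 ?sqr_ge0.
nra.
Qed.

Section Shear.
Variables (C c : R) (k : nat) (mu : R[i]) (t1 t2 : R[i] -> R[i]).
Hypotheses (C_ge : -1 <= C) (C_le : C <= 1) (c_gt0 : 0 < c).
Hypotheses (cn : c * k.+1%:R <= 2) (mu1 : nsq mu = 1).
(** The exponent n is written [k.+1], hence positive; [t1] and [t2] stand for rotated copies of T1
    and T2. *)
Let s u := mu * u ^+ k.+1.
Let g u := (quad C u * (1 + s u))^-1.
Hypothesis t1_der : forall u, unit_disk u -> cder t1 u (g u).
Hypothesis t2_der : forall u, unit_disk u -> cder t2 u (s u * g u).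

Let A u := t1 u + c%:C * (u * g u).
Let B u := t2 u - c%:C * (u * (s u * g u)).

Let m : R := c * k.+1%:R / 2.
Let P0 u := (1 - u ^+ 2) / quad C u.
Let K u := (1 - s u) / (1 + s u).
Let bb u := c%:C * P0 u + m%:C * K u.
Let A' u := g u * (1 - m%:C + bb u).
Let B' u := s u * g u * (1 - m%:C - bb u).

Let s_disk u : unit_disk u -> unit_disk (s u).
Proof.
move=> u1; rewrite /s mulrC; apply: unit_diskM mu1.
by rewrite /unit_disk /= normrX exprn_ilt1.
Qed.

Let nz u : unit_disk u -> [/\ quad C u != 0, 1 + s u != 0 & g u != 0].
Proof.
move=> u1; have [q0 _] := quad_facts C_ge C_le u1.
have [s0 _] := Re_cayley_gt0 (s_disk u1).
by rewrite invr_eq0 mulf_neq0.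
Qed.

Let s_der u : cder s u (k.+1%:R * mu * u ^+ k).
Proof.
apply: cder_eq (cderZ mu (cderX k.+1 (cder_id u))) _; rewrite /=; ring.
Qed.

Let quad_der u : cder (quad C) u (2 * C%:C + 2 * u).
Proof.
have := cderD (cderD (cder_cst 1 u) (cderZ (2 * C%:C) (cder_id u))) (cderX 2 (cder_id u)).
by move=> /cder_eq; apply; rewrite /= expr1; ring.
Qed.

Let g_der u : unit_disk u ->
  cder g u (- (((2 * C%:C + 2 * u) * (1 + s u) + quad C u * (k.+1%:R * mu * u ^+ k)) / (quad C u * (1 + s u)) ^+ 2)).
Proof.
move=> u1; have [q0 s0 _] := nz u1.
have h := cderM (quad_der u) (cderD (cder_cst 1 u) (s_der u)).
have := @cderV _ (fun u => quad C u * (1 + s u)) u _ (mulf_neq0 q0 s0) h.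
by move=> /cder_eq; apply; congr (- (_ / _)); ring.
Qed.

Let mE : m%:C = c%:C * k.+1%:R / 2.
Proof. by rewrite /m rmorphM rmorphM fmorphV !rmorph_nat. Qed.

(** A'/g = 1 + c (1 + u g'/g). Here 1 - u q'/q = (1 - u^2)/q, and the logarithmic derivative of 1 +
    s contributes -c n s/(1 + s) = -m + m (1 - s)/(1 + s). *)
Lemma A_der u : unit_disk u -> cder A u (A' u).
Proof.
move=> u1; have [q0 s0 _] := nz u1.
have := cderD (t1_der u1) (cderZ c%:C (cderM (cder_id u) (g_der u1))).
move=> /cder_eq; apply; rewrite /A' /bb mE /P0 /K.
(* In terms of u^k, the relation between s and its derivative is visible to [field]. *)
have sE : s u = mu * u ^+ k * u by rewrite /s exprS; ring.
move: q0 s0; rewrite /g sE /quad => q0 s0.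
by rewrite -[k.+1%:R]natr1; field; rewrite s0 q0.
Qed.

Lemma A_der0 : cder A 0 (1 + c%:C).
Proof.
apply: cder_eq (A_der (unit_disk0 R)) _.
rewrite /A' /g /bb /P0 /K /quad /s !expr0n /= !mulr0 !addr0 subr0 divr1 mulr1 invr1.
by ring.
Qed.

(** As for [A_der], except that u s'/s = n contributes a further -c n = -2m. *)
Lemma B_der u : unit_disk u -> cder B u (B' u).
Proof.
move=> u1; have [q0 s0 _] := nz u1.
have := cderB (t2_der u1) (cderZ c%:C (cderM (cder_id u) (cderM (s_der u) (g_der u1)))).
move=> /cder_eq; apply; rewrite /B' /bb mE /P0 /K.
have sE : s u = mu * u ^+ k * u by rewrite /s exprS; ring.
move: q0 s0; rewrite /g sE /quad => q0 s0.
by rewrite -[k.+1%:R]natr1; field; rewrite s0 q0.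
Qed.

Let Re_facts u : unit_disk u -> 0 < complex.Re (P0 u) /\ 0 < complex.Re (K u).
Proof.
move=> u1; split; first by have [_ ] := quad_facts C_ge C_le u1.
by have [] := Re_cayley_gt0 (s_disk u1).
Qed.

Let jac u : unit_disk u -> nsq (B' u) < nsq (A' u).
Proof.
move=> u1; have [_ _ g0] := nz u1; have [P1 K1] := Re_facts u1.
have m0 : 0 < m by rewrite !mulr_gt0.
apply: dilatation_bound => //.
- exact/unit_diskE/s_disk.
- rewrite /bb; move: P1 K1; case: (P0 u) => x y; case: (K u) => x' y' /= x0 x'0.
  have := mulr_gt0 c_gt0 x0; have := mulr_gt0 m0 x'0; lra.
- by rewrite /m ler_pdivrMr// mul1r.
Qed.

(** The sum of 1 + s and 1 - s weights b by 2/(1 + s) less its excess: collecting terms leaves (1 -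
    m) K + b, in which m K cancels. *)
Let AB_quad u : unit_disk u -> (A' u - B' u) * quad C u = K u + c%:C * P0 u.
Proof.
move=> u1; have [q0 s0 _] := nz u1.
rewrite /A' /B' /g /bb.
have -> : ((quad C u * (1 + s u))^-1 * (1 - m%:C + (c%:C * P0 u + m%:C * K u)) -
   s u * (quad C u * (1 + s u))^-1 * (1 - m%:C - (c%:C * P0 u + m%:C * K u))) * quad C u =
   (1 - m%:C) * ((1 - s u) / (1 + s u)) + (c%:C * P0 u + m%:C * K u).
  by field; rewrite q0 s0.
by rewrite -/(K u); ring.
Qed.

(** In chart coordinates the real and imaginary parts of F satisfy the hypotheses on level curves;
    injectivity, openness and horizontal slices follow from [level_inj], [level_open] and
    [level_path]. *)
Lemma shear_image : let F u := A u + (B u)^* in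
  [/\ set_inj (@unit_disk R) F,
      forall u, unit_disk u -> exists2 e : R, 0 < e & forall p : R[i],
        `|complex.Re p - complex.Re (F u)| < e ->
        `|complex.Im p - complex.Im (F u)| < e ->
        exists2 z, unit_disk z & F z = p &
      forall v : R, exists2 w : R -> R, continuous w & forall p : R[i],
        ((exists2 z, unit_disk z & F z = p) /\ complex.Im p = v) <->
        exists x, p = w x +i* v].
Proof.
move=> F; have [Psi [a [b [Pd Ps dP ori [flow unb]]]]] := chart_exists C_ge C_le.
pose U x y := complex.Re (A (Psi x y) + B (Psi x y)).
pose V x y := complex.Im (A (Psi x y) - B (Psi x y)).
have FE x y : F (Psi x y) = U x y +i* V x y.
  by rewrite /F /U /V; case: (A _) => ? ?; case: (B _).
have dU x y : diff2 U x y (complex.Re ((A' (Psi x y) + B' (Psi x y)) * a x y))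
    (complex.Re ((A' (Psi x y) + B' (Psi x y)) * b x y)).
  apply: cdiff2_Re; apply: (@cdiff2_comp _ (fun u => A u + B u)) (dP x y).
  by apply: cderD; [exact: A_der|exact: B_der].
have dV x y : diff2 V x y (complex.Im ((A' (Psi x y) - B' (Psi x y)) * a x y))
    (complex.Im ((A' (Psi x y) - B' (Psi x y)) * b x y)).
  apply: cdiff2_Im; apply: (@cdiff2_comp _ (fun u => A u - B u)) (dP x y).
  by apply: cderB; [exact: A_der|exact: B_der].
have VyE x y lam : b x y = 'i%C * lam%:C * quad C (Psi x y) ->
    complex.Im ((A' (Psi x y) - B' (Psi x y)) * b x y) =
    lam * (complex.Re (K (Psi x y)) + c * complex.Re (P0 (Psi x y))).
  move=> ->.
  have -> : (A' (Psi x y) - B' (Psi x y)) * ('i%C * lam%:C * quad C (Psi x y)) =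
    'i%C * lam%:C * ((A' (Psi x y) - B' (Psi x y)) * quad C (Psi x y)) by ring.
  by rewrite AB_quad//; case: (K _) => ? ?; case: (P0 _) => ? ? /=; ring.
have Vy0 x y : 0 < complex.Im ((A' (Psi x y) - B' (Psi x y)) * b x y).
  have [lam lam0 bE] := flow x y; have [P1 K1] := Re_facts (Pd x y).
  by rewrite (VyE _ _ _ bE) mulr_gt0// addr_gt0// mulr_gt0.
have jac0 x y : 0 < complex.Re ((A' (Psi x y) + B' (Psi x y)) * a x y) *
      complex.Im ((A' (Psi x y) - B' (Psi x y)) * b x y) -
    complex.Re ((A' (Psi x y) + B' (Psi x y)) * b x y) *
      complex.Im ((A' (Psi x y) - B' (Psi x y)) * a x y).
  (* The Jacobian is (|A'|^2 - |B'|^2) times the orientation factor of the chart. *)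
  have := ori x y; have := jac (Pd x y); rewrite -subr_gt0 => h1 h2.
  have := mulr_gt0 h1 h2; move: (A' _) (B' _) (a x y) (b x y).
  move=> [p1 p2] [q1 q2] [a1 a2] [b1 b2]; rewrite /nsq /= => h3.
  by apply: (lt_le_trans h3); rewrite le_eqVlt; apply/orP; left; apply/eqP; ring.
have unbV x M : (exists y, M < V x y) /\ (exists y, V x y < M).
  pose W y := complex.Im (Psi x y / quad C (Psi x y)).
  pose k0 := V x 0 - c * W 0.
  (* The derivative of V - c W along a leaf is lam Re K > 0. Hence V exceeds c W plus a constant for
     y >= 0 and lies below it for y <= 0, which explains the signs of y in [disk_chart]. *)
  have mono : {homo (fun y => V x y - c * W y) : y y' / y <= y'}.
    have dW y : cder W y (complex.Im (P0 (Psi x y) / quad C (Psi x y) * b x y)).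
      have [q0 _ _] := nz (Pd x y).
      have h := cderM (cder_id (Psi x y)) (cderV q0 (quad_der (Psi x y))).
      have := diff2_y (cdiff2_Im (cdiff2_comp h (dP x y))).
      move=> /cder_eq; apply; congr (complex.Im (_ * _)).
      by move: q0; rewrite /P0 /quad => q0; field.
    apply: cder_ndecr => [y|y].
      exact: cderB (diff2_y (dV x y)) (cderZ c (dW y)).
    have [lam lam0 bE] := flow x y; have [P1 K1] := Re_facts (Pd x y).
    have [q0 _ _] := nz (Pd x y).
    rewrite (VyE _ _ _ bE) bE.
    have -> : P0 (Psi x y) / quad C (Psi x y) * ('i%C * lam%:C * quad C (Psi x y)) =
      'i%C * lam%:C * P0 (Psi x y) by field.
    have -> : complex.Im ('i%C * lam%:C * P0 (Psi x y)) = lam * complex.Re (P0 (Psi x y)).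
      by case: (P0 _) => ? ? /=; ring.
    have := mulr_gt0 lam0 K1; lra.
  have [[y y0 My] _] := unb x ((M - k0) / c).
  have [_ [y' y'0 My']] := unb x ((M - k0) / c).
  rewrite -/(W y) ltr_pdivrMr// in My; rewrite -/(W y') ltr_pdivlMr// in My'.
  have lo (p q r : R) : r <= p - c * q -> M - r < q * c -> M < p by lra.
  have hi (p q r : R) : p - c * q <= r -> q * c < M - r -> p < M by lra.
  split; [exists y; exact: lo (mono _ _ y0) My|exists y'; exact: hi (mono _ _ y'0) My'].
split.
- move=> z z'; rewrite !inE => /Ps[x [y <-]] /Ps[x' [y' <-]].
  rewrite !FE => Uxy.
  by have [-> ->] := level_inj dU dV Vy0 jac0 unbV (congr1 (@complex.Re R) Uxy) (congr1 (@complex.Im R) Uxy).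
- move=> u /Ps[x [y <-]]; have [e e0 he] := level_open dU dV Vy0 jac0 unbV x y.
  exists e => // p; rewrite FE /= => h1 h2.
  have [x' [y' [h3 h4]]] := he _ _ h1 h2.
  by exists (Psi x' y') => //; rewrite FE h3 h4; case: (p).
- move=> v; have [w [wc h1 h2]] := level_path dU dV Vy0 unbV v.
  exists w => // p; split.
    move=> [[z /Ps[x [y <-]] <-]]; rewrite FE /= => Vv.
    by exists x; rewrite (h1 _ _ Vv) Vv.
  move=> [x ->]; split => //; have [y Vv] := h2 x.
  by exists (Psi x y) => //; rewrite FE Vv (h1 _ _ Vv).
Qed.

End Shear.
End Core.

(** * Convolution with half-plane mappings *)

Section HadamardHalfPlane.
Variable R : realType.
Implicit Types (b d t : nat -> R[i]) (f T : R[i] -> R[i]) (z zeta kappa tau : R[i]).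

Lemma unit_diskZ zeta z : `|zeta| <= 1 -> unit_disk z -> unit_disk (zeta * z).
Proof.
by move=> z1 zd; rewrite /unit_disk /= normrM (le_lt_trans _ zd)// ler_piMl.
Qed.

Lemma one_sub_neq0 z : unit_disk z -> 1 - z != 0.
Proof.
move=> z1; apply/eqP => /eqP; rewrite subr_eq0 => /eqP h.
by move: z1; rewrite /unit_disk /= -h normr1 ltxx.
Qed.

(** The coefficients come from multiplying [b] by the geometric series of zeta z^n. *)
Lemma psum_series_exists b zeta n : (0 < n)%N -> `|zeta| <= 1 -> tame b ->
  exists2 d, tame d & forall z, unit_disk z -> psum d z = psum b z / (1 - zeta * z ^+ n).
Proof.
move=> n0 zeta1 tb.
pose d k := \sum_(j < (k %/ n).+1) zeta ^+ j * b (k - j * n)%N.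
have d_lt k : (k < n)%N -> d k = b k.
  by move=> kn; rewrite /d divn_small// big_ord_recl big_ord0 addr0 mul1r subn0.
have d_ge k : d (n + k)%N = b (n + k)%N + zeta * d k.
  rewrite /d divnDl// divnn n0 add1n big_ord_recl mul1r subn0; congr (_ + _).
  rewrite mulr_sumr; apply: eq_bigr => j _.
  by rewrite /= /bump /= add1n exprS -mulrA mulSn subnDl.
have td := tame_div n0 zeta1 tb d_lt d_ge.
exists d => // z z1; rewrite -(psum_div n0 zeta1 tb d_lt d_ge z1) mulfK//.
apply/one_sub_neq0/unit_diskZ => //.
by rewrite /unit_disk /= normrX exprn_ilt1// -lt0n.
Qed.

(** The function is, up to a constant, kappa/2 times z/(1 - zeta z) + tau z/(1 - zeta z)^2. Dividing
    the linear numerator [b0] three times by 1 - zeta z produces [b1], [b2] and [h]. *)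
Lemma halfplane_psum kappa zeta tau f :
  `|zeta| <= 1 -> (forall z, unit_disk z -> cder f z
     (kappa * ((1 + tau) / 2 + (tau - 1) / 2 * (zeta * z)) / (1 - zeta * z) ^+ 3)) ->
  let h k := kappa * zeta ^+ k * k.+1%:R * (1 + tau * k.+1%:R) / 2 in
  tame h /\ forall z, unit_disk z -> f z = psum (antid (f 0) h) z.
Proof.
move=> zeta1 fd h.
pose b0 k : R[i] := match k with 0%N => kappa * (1 + tau) / 2
  | 1%N => kappa * ((tau - 1) / 2) * zeta | _ => 0 end.
pose b1 k : R[i] := if k is 0%N then kappa * (1 + tau) / 2 else kappa * tau * zeta ^+ k.
pose b2 k : R[i] := kappa * zeta ^+ k * (1 + tau * (2 * k%:R + 1)) / 2.
have b00 k : (2 <= k)%N -> b0 k = 0 by case: k => [|[|k]].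
have e1 k : (k < 1)%N -> b1 k = b0 k by case: k.
have e1' k : b1 (1 + k)%N = b0 (1 + k)%N + zeta * b1 k.
  case: k => [|k]; first by rewrite /b1 /b0 /= expr1; field.
  by rewrite add1n /b1 /b0 add0r [zeta ^+ k.+2]exprS; ring.
have e2 k : (k < 1)%N -> b2 k = b1 k.
  by case: k => // _; rewrite /b2 /b1 expr0; field.
have e2' k : b2 (1 + k)%N = b1 (1 + k)%N + zeta * b2 k.
  by rewrite add1n /b2 /b1 -[k.+1%:R]natr1 exprS; field.
have e3 k : (k < 1)%N -> h k = b2 k.
  by case: k => // _; rewrite /h /b2 expr0; field.
have e3' k : h (1 + k)%N = b2 (1 + k)%N + zeta * h k.
  by rewrite /h /b2 add1n -[k.+2%:R]natr1 -[k.+1%:R]natr1 exprS; field.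
have t0 := tame_finite b00.
have t1 := tame_div (ltnSn 0) zeta1 t0 e1 e1'.
have t2 := tame_div (ltnSn 0) zeta1 t1 e2 e2'.
have t3 := tame_div (ltnSn 0) zeta1 t2 e3 e3'.
split=> //; apply: psum_antid => // z z1; apply: cder_eq (fd z z1) _.
have w0 := one_sub_neq0 (unit_diskZ zeta1 z1).
have := psum_div (ltnSn 0) zeta1 t0 e1 e1' z1.
have := psum_div (ltnSn 0) zeta1 t1 e2 e2' z1.
have := psum_div (ltnSn 0) zeta1 t2 e3 e3' z1.
rewrite (psum_finite z b00) !big_ord_recl big_ord0 /= expr1 => <- <- h0.
have -> : kappa * ((1 + tau) / 2 + (tau - 1) / 2 * (zeta * z)) =
  kappa * (1 + tau) / 2 * z ^+ 0 + (kappa * ((tau - 1) / 2) * zeta * z ^+ bump 0 0 + 0).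
  by rewrite /bump /= expr0 expr1; ring.
by rewrite -h0; field.
Qed.

(* Coefficientwise, z/(1 - zeta z)^2 acts as z d/dz and z/(1 - zeta z) as the identity. *)
Lemma hadamard_halfplane kappa zeta tau f T d :
  `|zeta| <= 1 -> zeta != 0 -> (forall z, unit_disk z -> cder f z
     (kappa * ((1 + tau) / 2 + (tau - 1) / 2 * (zeta * z)) / (1 - zeta * z) ^+ 3)) ->
  tame d -> T 0 = 0 -> (forall z, unit_disk z -> cder T z (psum d z)) ->
  forall z, unit_disk z -> hadamard f T z =
    kappa / (2 * zeta) * (T (zeta * z) + tau * (zeta * z * psum d (zeta * z))).
Proof.
move=> zeta1 zeta0 fd td T0 Td z z1.
have [th fE] := halfplane_psum zeta1 fd; set h := (fun k => _) in th fE.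
have TE := psum_antid td Td; rewrite T0 in TE.
have tT := tame_antid 0 td.
have w1 := unit_diskZ zeta1 z1; set w := zeta * z in w1 *.
have cT := tame_cvg tT w1; have cd := tame_cvg td w1.
(* Index k of [d] pairs with index k + 1 of T; the zeroth term vanishes because T 0 = 0. *)
rewrite -(cvg_shiftn 1) in cT; rewrite TE//.
rewrite /hadamard; apply: (cvg_lim (@norm_hausdorff _ (R[i]^o))).
rewrite -(cvg_shiftn 1).
have -> : [sequence series (fun k => taylor_coef f k * taylor_coef T k * z ^+ k : R[i]^o) (n + 1)%N]_n
  = (fun n => kappa / (2 * zeta) * (series (fun k => antid 0 d k * w ^+ k : R[i]^o) (n + 1)%N +
     tau * (w * series (fun k => d k * w ^+ k : R[i]^o) n))).
  apply/funext => N /=; rewrite /series /= !big_mkord addn1 !big_ord_recl /=.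
  rewrite (taylor_coef_psum 0 tT TE) /= mulr0 !mul0r !add0r.
  rewrite [w * _]mulr_sumr [tau * _]mulr_sumr -big_split /= mulr_sumr.
  apply: eq_bigr => k _; rewrite /bump /= add1n.
  rewrite (taylor_coef_psum _ tT TE) (taylor_coef_psum _ (tame_antid _ th) fE) /= /h /w.
  have k0 : k.+1%:R != 0 :> R[i] by rewrite pnatr_eq0.
  by rewrite !exprMn !exprS; field; rewrite zeta0 nat1r k0.
apply: (@cvgM _ _ _ _ (cst (kappa / (2 * zeta)))); first exact: cvg_cst.
apply: cvgD; first exact: cT.
apply: (@cvgM _ _ _ _ (cst tau)); first exact: cvg_cst.
by apply: (@cvgM _ _ _ _ (cst w)); [exact: cvg_cst|exact: cd].
Qed.

End HadamardHalfPlane.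

(** * Openness, connectedness and directional convexity of the image *)

Section Images.
Variable R : realType.
Implicit Types (u w z xi : R[i]) (F A B : R[i] -> R[i]).

Lemma harmonic_continuous A B u a b : cder A u a -> cder B u b ->
  forall e : R[i], 0 < e -> exists2 r : R, 0 < r & forall h, `|h| < r%:C ->
    `|(A (u + h) + (B (u + h))^*) - (A u + (B u)^*)| < e.
Proof.
move=> /cder_lip[r1 r10 h1] /cder_lip[r2 r20 h2] e e0.
have r1E : r1 = (complex.Re r1)%:C by rewrite RRe_real // gtr0_real.
have r2E : r2 = (complex.Re r2)%:C by rewrite RRe_real // gtr0_real.
have eE : e = (complex.Re e)%:C by rewrite RRe_real // gtr0_real.
rewrite r1E ltcR in r10; rewrite r2E ltcR in r20; rewrite eE ltcR in e0.
pose K := complex.Re `|a| + 1 + (complex.Re `|b| + 1).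
have K0 : 0 < K by rewrite addr_gt0// ltr_wpDl// Re_norm_ge0.
exists (Num.min (Num.min (complex.Re r1) (complex.Re r2)) (complex.Re e / K)).
  by rewrite !lt_min r10 r20 divr_gt0.
move=> h; rewrite (norm_RRe h) ltcR !lt_min => /andP[/andP[hr1 hr2] hr3].
have k1 : `|h| < r1 by rewrite r1E (norm_RRe h) ltcR.
have k2 : `|h| < r2 by rewrite r2E (norm_RRe h) ltcR.
have -> : A (u + h) + (B (u + h))^* - (A u + (B u)^*) =
  (A (u + h) - A u) + (B (u + h) - B u)^* by rewrite rmorphB /=; ring.
rewrite (le_lt_trans (ler_normD _ _))// normcJ (le_lt_trans (lerD (h1 _ k1) (h2 _ k2)))//.
rewrite -mulrDl (norm_RRe a) (norm_RRe b) (norm_RRe h) -[1]/(1%:C) -!rmorphD -rmorphM.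
by rewrite eE ltcR mulrC -ltr_pdivlMr.
Qed.

Lemma line_continuous (w : R -> R) (rho : R[i]) (v : R) : continuous w ->
  continuous (fun x => (w x +i* v) / rho : R[i]^o).
Proof.
move=> wc x; apply: (@cvgM _ _ _ _ (fun x => w x +i* v : R[i]^o)); last exact: cvg_cst.
apply/cvgrPdist_lt => e e0.
have eE : e = (complex.Re e)%:C by rewrite RRe_real // gtr0_real.
have e0' : 0 < complex.Re e by rewrite -ltcR -eE.
have /cvgrPdist_lt/(_ _ e0') := wc x.
apply: filterS => y wy.
have -> : (w x +i* v) - (w y +i* v) = (w x - w y)%:C.
  by apply/eqP; rewrite eq_complex /= subrr !eqxx.
by rewrite normcR eE ltcR.
Qed.

Variables (A B F : R[i] -> R[i]) (A' B' : R[i] -> R[i]) (xi : R[i]) (psi : R).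
Let F0 u := A u + (B u)^*.
Hypothesis dA : forall u, unit_disk u -> cder A u (A' u).
Hypothesis dB : forall u, unit_disk u -> cder B u (B' u).
Hypotheses (xi1 : nsq xi = 1) (xipsi : xi * cis psi = 1).
Hypothesis FE : forall z, unit_disk z -> F z = F0 (xi * z) / (2 * xi).
Hypothesis F0_open : forall u, unit_disk u -> exists2 e : R, 0 < e & forall p : R[i],
        `|complex.Re p - complex.Re (F0 u)| < e ->
        `|complex.Im p - complex.Im (F0 u)| < e ->
        exists2 z, unit_disk z & F0 z = p.
Hypothesis F0_slices : forall v : R, exists2 w : R -> R, continuous w & forall p : R[i],
        ((exists2 z, unit_disk z & F0 z = p) /\ complex.Im p = v) <->
        exists x, p = w x +i* v.

Let xi0 : xi != 0. Proof. by rewrite -nsq_gt0 xi1. Qed.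

Let rho0 : 2 * xi != 0. Proof. by rewrite mulf_neq0// pnatr_eq0. Qed.

Let xi_disk z : unit_disk z -> unit_disk (xi * z).
Proof. by move=> z1; rewrite mulrC; exact: unit_diskM. Qed.

Let image_iff p : (F @` (@unit_disk R)) p <-> exists2 u, unit_disk u & F0 u = 2 * xi * p.
Proof.
split=> [[z z1 <-]|[u u1 uE]].
  by exists (xi * z); [exact: xi_disk|rewrite FE// [RHS]mulrC divfK].
have nV : nsq xi^-1 = 1.
  by apply: (mulIf (oner_neq0 R)); rewrite -[X in _ * X]xi1 -nsq_mul mulVf// mulr1 /nsq /= expr1n expr0n addr0.
exists (u / xi); first exact: unit_diskM.
rewrite FE; last exact: unit_diskM.
by rewrite [xi * _]mulrC divfK// uE [LHS]mulrC mulKf.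
Qed.

Lemma image_open : open (F @` (@unit_disk R) : set R[i]^o).
Proof.
rewrite openE => p /image_iff[u u1 uE]; have [e e0 he] := F0_open u1.
apply/nbhs_ballP; exists (e / 2)%:C => /=; first by rewrite ltcR divr_gt0.
move=> q; rewrite /ball /= => pq; apply/image_iff.
have nrm : `|2 * xi * q - 2 * xi * p| < e%:C.
  rewrite -mulrBr normrM distrC normrM.
  have -> : `|xi| = 1.
    by apply/eqP; rewrite -(@pexpr_eq1 _ _ 2)// nsqE xi1.
  rewrite mulr1 normr_nat mulrC -ltr_pdivlMr//.
  by have -> : e%:C / 2 = (e / 2)%:C by rewrite rmorphM fmorphV rmorph_nat.
apply: he; rewrite -ltcR uE -raddfB.
  exact: le_lt_trans (normc_ge_Re _) nrm.
exact: le_lt_trans (normc_ge_Im _) nrm.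
Qed.

(** The image is the union of the curves traced by the radii, all of which start at the same
    point. *)
Lemma image_connected : connected (F @` (@unit_disk R) : set R[i]^o).
Proof.
have -> : (F @` (@unit_disk R) : set R[i]^o) =
  \bigcup_(u in @unit_disk R) ((fun t : R => F0 (t%:C * u) / (2 * xi) : R[i]^o) @` `[0, 1]%classic).
  apply/seteqP; split.
    move=> p /image_iff[u u1 uE]; exists u => //; exists 1; first by rewrite /= in_itv /= ler01 lexx.
    by rewrite mul1r uE [LHS]mulrC mulKf.
  move=> p [u u1 [t /= ht <-]]; apply/image_iff; exists (t%:C * u); last by rewrite [RHS]mulrC divfK.
  move: ht u1; rewrite in_itv /= => /andP[t0 t1]; rewrite /unit_disk /= => u1.
  by rewrite normrM (le_lt_trans _ u1)// ler_piMl// normcR ger0_norm// -[1]/(1%:C) lecR.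
apply: bigcup_connected.
  exists (F0 0 / (2 * xi)) => u u1; exists 0; first by rewrite /= in_itv /= lexx ler01.
  by rewrite mul0r.
move=> u u1; apply: connected_continuous_connected; first exact: segment_connected.
apply: continuous_in_subspaceT => t; rewrite inE /= in_itv /= => /andP[t0 t1].
apply: (@cvgM _ _ _ _ (fun t : R => F0 (t%:C * u) : R[i]^o)); last exact: cvg_cst.
have tu1 : unit_disk (t%:C * u).
  rewrite /unit_disk /= normrM (le_lt_trans _ u1)// ler_piMl// normcR ger0_norm// -[1]/(1%:C) lecR.
  exact: t1.
apply/cvgrPdist_lt => e e0; have [r r0 hr] := harmonic_continuous (dA tu1) (dB tu1) e0.
apply/nbhs_ballP; exists r => //= s; rewrite /ball /= => ts.
rewrite distrC; have -> : s%:C * u = t%:C * u + (s - t)%:C * u.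
  by rewrite rmorphB /=; ring.
apply: hr; rewrite normrM normcR distrC.
by rewrite (le_lt_trans (ler_piMr _ (ltW u1))) ?ler0c ?ltcR.
Qed.

(** Multiplication by 2 xi makes lines of direction psi horizontal, so the slice is a continuous
    image of the real line. *)
Lemma image_convex : convex_in_direction (F @` (@unit_disk R)) psi.
Proof.
move=> p; set v := complex.Im (2 * xi * p).
have [w wc wE] := F0_slices v.
have -> : (F @` (@unit_disk R) : set R[i]^o) `&` line p psi =
   (fun x => (w x +i* v) / (2 * xi) : R[i]^o) @` [set: R].
  apply/seteqP; split.
    move=> q [/image_iff hq [t _ qE]].
    have Imq : complex.Im (2 * xi * q) = v.
      rewrite /v -qE mulrDr.
      have -> : 2 * xi * (t%:C * cis psi) = 2 * t%:C * (xi * cis psi) by ring.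
      by rewrite xipsi; case: (2 * xi * p) => ? ? /=; ring.
    have [x xE] : exists x, 2 * xi * q = w x +i* v by apply/wE.
    by exists x => //; rewrite -xE [LHS]mulrC mulKf.
  move=> q [x _ <-]; split.
    apply/image_iff; rewrite [2 * xi * _]mulrC divfK//.
    by have /wE[] : exists y, w x +i* v = w y +i* v by exists x.
  (* Moving by t along the line moves 2 xi p by the real number 2 t. *)
  exists ((w x - complex.Re (2 * xi * p)) / 2) => //.
  have cE : cis psi = xi^-1 by rewrite -[LHS]mul1r -(mulVf xi0) -mulrA xipsi mulr1.
  rewrite cE rmorphM fmorphV rmorph_nat rmorphB.
  have -> : w x +i* v = 2 * xi * p + ((w x)%:C - (complex.Re (2 * xi * p))%:C).
    rewrite /v; case: (2 * xi * p) => ? ? /=; apply/eqP; rewrite eq_complex /=.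
    by apply/andP; split; apply/eqP; ring.
  by field.
apply: connected_continuous_connected; first by apply/connected_intervalP => a b c.
by apply: continuous_subspaceT; exact: line_continuous.
Qed.

Lemma image_maps_convex : maps_convex_in_direction F psi.
Proof.
by split; [exact: image_open|exact: image_connected|exact: image_convex].
Qed.

End Images.

(** * Points of the unit circle *)

Section Cis.
Variable R : realType.
Implicit Types (x y : R).

Lemma nsq_cis x : nsq (cis x) = 1. Proof. exact: cos2Dsin2. Qed.

Lemma cisD x y : cis (x + y) = cis x * cis y.
Proof.
by apply/eqP; rewrite eq_complex /= cosD sinD addrC [X in _ && (X == _)]addrC !eqxx.
Qed.

Lemma cis0 : cis 0 = 1 :> R[i]. Proof. by rewrite /cis cos0 sin0. Qed.

Lemma cisN x : cis (- x) = (cis x)^*.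
Proof. by rewrite /cis cosN sinN. Qed.

Lemma cisNM x : cis (- x) * cis x = 1.
Proof. by rewrite -cisD addNr cis0. Qed.

Lemma cis_neq0 x : cis x != 0.
Proof. by rewrite -nsq_gt0 nsq_cis. Qed.

Lemma norm_cis x : `|cis x| = 1.
Proof. by apply/eqP; rewrite -(@pexpr_eq1 _ _ 2)// nsqE nsq_cis. Qed.

Lemma cisD_cisN x : cis x + cis (- x) = 2 * (cos x)%:C.
Proof.
rewrite cisN; apply/eqP; rewrite eq_complex /=.
by apply/andP; split; apply/eqP; ring.
Qed.

Lemma quad_cis (eta gamma : R) (z : R[i]) :
  (1 + z * cis (eta + gamma)) * (1 + z * cis (- (eta - gamma))) =
  quad (cos eta) (z * cis gamma).
Proof.
rewrite opprB (addrC gamma) !cisD /quad -cisD_cisN.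
have -> : (1 + z * (cis eta * cis gamma)) * (1 + z * (cis (- eta) * cis gamma)) =
  1 + (cis eta + cis (- eta)) * (z * cis gamma) + (cis (- eta) * cis eta) * (z * cis gamma) ^+ 2 by ring.
by rewrite cisNM mul1r.
Qed.

End Cis.

(** * Derivatives determined by the shear equations *)

Section Shears.
Variable R : realType.

(** With w = zeta z, the identity 1 + (a - w)/(1 - a w) = (1 + a)(1 - w)/(1 - a w) gives H' = (1 - a
    w)/((1 + a)(1 - w)^3). The derivatives are put in the form of [hadamard_halfplane], with tau = c
    for H and tau = -c for G. *)
Lemma slanted_derivatives (alpha a : R) (H G : R[i] -> R[i]) (c : R) :
  -1 < a < 1 -> c = (1 - a) / (1 + a) ->
  S_Hslanted alpha H G ->
  has_dilatation H G (fun z =>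
       cis (2 * alpha) * ((a%:C - z * cis alpha) / (1 - a%:C * z * cis alpha))) ->
  let zeta := cis alpha in
  (forall z, unit_disk z -> cder H z
     (1 * ((1 + c%:C) / 2 + (c%:C - 1) / 2 * (zeta * z)) / (1 - zeta * z) ^+ 3)) /\
  (forall z, unit_disk z -> cder G z
     (zeta ^+ 2 * ((1 + (- c%:C)) / 2 + ((- c%:C) - 1) / 2 * (zeta * z)) / (1 - zeta * z) ^+ 3)).
Proof.
move=> /andP[a1 a2] cE [[aH aG] HG _] dil zeta.
have zz : cis (- 2 * alpha) * zeta ^+ 2 = 1.
  by rewrite expr2 -cisD (_ : - 2 * alpha = - (alpha + alpha)) ?cisNM//; ring.
have z2 : cis (2 * alpha) = zeta ^+ 2.
  by rewrite expr2 -cisD; congr cis; ring.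
have a0 : 1 + a%:C != 0.
  by rewrite eq_complex /= negb_and gt_eqF//; lra.
have zeta1 : `|zeta| <= 1 by rewrite norm_cis.
have cC : c%:C = (1 - a%:C) / (1 + a%:C).
  by rewrite cE rmorphM fmorphV rmorphB rmorphD.
have key z : unit_disk z ->
    cderive H z = 1 * ((1 + c%:C) / 2 + (c%:C - 1) / 2 * (zeta * z)) / (1 - zeta * z) ^+ 3 /\
    cderive G z = zeta ^+ 2 * ((1 + (- c%:C)) / 2 + ((- c%:C) - 1) / 2 * (zeta * z)) / (1 - zeta * z) ^+ 3.
  move=> z1; have w1 := one_sub_neq0 (unit_diskZ zeta1 z1).
  have aw : 1 - a%:C * (zeta * z) != 0.
    apply: one_sub_neq0; apply: unit_diskZ; last exact: unit_diskZ.
    by rewrite normcR -[1]/(1%:C) lecR ler_norml; lra.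
  have [H0 GH] := dil _ z1.
  have dH := derivable_cder (aH _ z1); have dG := derivable_cder (aG _ z1).
  have dHG := cderD dH (cderZ (cis (- 2 * alpha)) dG).
  have dR : cder (fun z => (1 * z + 0) / ((- zeta) * z + 1)) z (1 / (1 - zeta * z) ^+ 2).
    have e0 : - zeta * z + 1 = 1 - zeta * z by ring.
    apply: cder_eq (cder_mobius 1 0 _) _; first by rewrite e0.
    by rewrite e0; congr (_ / _); ring.
  have E : cderive H z + cis (- 2 * alpha) * cderive G z = 1 / (1 - zeta * z) ^+ 2.
    apply: (cder_uniq dHG); apply: (cder_disk _ z1 dR) => x x1.
    by rewrite HG// mul1r addr0 /zeta; congr (_ / _); ring.
  have GE : cderive G z = zeta ^+ 2 * ((a%:C - zeta * z) / (1 - a%:C * (zeta * z))) * cderive H z.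
    rewrite -[LHS](divfK H0) GH z2; congr (_ * _ * _).
    by rewrite /zeta; congr (_ / _); ring.
  have E2 : (1 + (a%:C - zeta * z) / (1 - a%:C * (zeta * z))) * cderive H z = 1 / (1 - zeta * z) ^+ 2.
    by rewrite -E GE -[zeta ^+ 2 * _ * _]mulrA [cis _ * _]mulrA zz; ring.
  have E3 : cderive H z = (1 - a%:C * (zeta * z)) / ((1 + a%:C) * (1 - zeta * z) ^+ 3).
    have f0 : 1 + (a%:C - zeta * z) / (1 - a%:C * (zeta * z)) = (1 + a%:C) * (1 - zeta * z) / (1 - a%:C * (zeta * z)).
      by field.
    rewrite f0 in E2.
    apply: (mulfI (mulf_neq0 (mulf_neq0 a0 w1) (invr_neq0 aw))); rewrite E2.
    by field; rewrite a0 w1 aw.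
  split; first by rewrite E3 cC; field; rewrite a0 w1.
  by rewrite GE E3 cC; field; rewrite a0 w1 aw.
by split=> z z1; have [h1 h2] := key z z1; rewrite -?h1 -?h2; apply: derivable_cder; [exact: aH|exact: aG].
Qed.

(** Substituting T2' = e^(i theta) z^n T1' into the differentiated shear equation leaves a linear
    equation for T1'. *)
Lemma shear_derivatives (n : nat) (theta eta gamma : R) (f T1 T2 : R[i] -> R[i]) :
  (0 < n)%N -> analytic_on_disk f ->
  (forall z, unit_disk z ->
       z * cderive f z =
       z / ((1 + z * cis (eta + gamma)) * (1 + z * cis (- (eta - gamma))))) ->
  S_H T1 T2 ->
  (forall z, unit_disk z -> T1 z + cis (- 2 * gamma) * T2 z = f z) ->
  has_dilatation T1 T2 (fun z => cis theta * z ^+ n) ->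
  forall z, unit_disk z ->
    let D := quad (cos eta) (z * cis gamma) * (1 + cis (- 2 * gamma) * cis theta * z ^+ n) in
    D != 0 /\ cder T1 z D^-1 /\ cder T2 z (cis theta * z ^+ n / D).
Proof.
move=> n0 af df [[a1 a2] _ _ _ T1'0] sh dil z z1 D.
have [T10 TT] := dil _ z1.
have d1 := derivable_cder (a1 _ z1); have d2 := derivable_cder (a2 _ z1).
have E : cderive T1 z + cis (- 2 * gamma) * cderive T2 z = cderive f z.
  apply: (cder_uniq (cderD d1 (cderZ _ d2))).
  by apply: (cder_disk _ z1 (derivable_cder (af _ z1))) => x x1; rewrite sh.
have T2E : cderive T2 z = cis theta * z ^+ n * cderive T1 z by rewrite -[LHS](divfK T10) TT.
have [q0 _] := @quad_facts R (cos eta) (z * cis gamma) (cos_geN1 _) (cos_le1 _) (unit_diskM z1 (nsq_cis _)).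
have fE : cderive f z = (quad (cos eta) (z * cis gamma))^-1.
  (* The equation for z f'(z) says nothing at 0; there f'(0) = 1 follows from T1'(0) = 1 and n >
     0. *)
  have [zE|z0] := eqVneq z 0.
    rewrite -E T2E zE T1'0 expr0n eqn0Ngt n0 /= mulr0 mul0r mulr0 addr0.
    by rewrite /quad mul0r mulr0 expr0n addr0 addr0 invr1.
  by apply: (mulfI z0); rewrite df// quad_cis.
have D0 : 1 + cis (- 2 * gamma) * cis theta * z ^+ n != 0.
  rewrite -mulrA -[X in 1 + X]opprK; apply: one_sub_neq0; rewrite /unit_disk /= normrN.
  by rewrite !normrM !norm_cis !mul1r normrX exprn_ilt1// -lt0n.
have T1E : cderive T1 z = D^-1.
  apply: (mulfI D0); rewrite /D invfM mulrCA mulfV// mulr1 -fE -E T2E; ring.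
split; first by rewrite mulf_neq0.
by rewrite -T1E -T2E.
Qed.

End Shears.

(** * Series of the shear and final assembly *)

Section Assembly.
Variable R : realType.

Lemma psum_monomial (kappa : R[i]) (n : nat) :
  let b k := if k == n then kappa else 0 in
  tame b /\ forall z, psum b z = kappa * z ^+ n.
Proof.
move=> b; have b0 k : (n.+1 <= k)%N -> b k = 0 by move=> nk; rewrite /b gtn_eqF.
split; first exact: tame_finite b0.
move=> z; rewrite (psum_finite z b0) big_ord_recr /= big1 ?add0r /b ?eqxx// => k _.
by rewrite ltn_eqF// mul0r.
Qed.

(** Three divisions: by the two linear factors of [quad], then by 1 + nu z^n. *)
Lemma shear_psum (eta gamma : R) (nu : R[i]) (n : nat) (b : nat -> R[i]) :
  (0 < n)%N -> `|nu| <= 1 -> tame b -> exists2 d, tame d & forall z, unit_disk z ->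
    psum d z = psum b z / (quad (cos eta) (z * cis gamma) * (1 + nu * z ^+ n)).
Proof.
move=> n0 nu1 tb.
have le1 x : `|- cis x| <= 1 :> R[i] by rewrite normrN norm_cis.
have [d1 t1 E1] := psum_series_exists (ltnSn 0) (le1 (eta + gamma)) tb.
have [d2 t2 E2] := psum_series_exists (ltnSn 0) (le1 (- (eta - gamma))) t1.
have nu1' : `|- nu| <= 1 by rewrite normrN.
have [d3 t3 E3] := psum_series_exists n0 nu1' t2.
exists d3 => // z z1; rewrite E3// E2// E1// -quad_cis !invfM !mulrA.
rewrite !expr1 !mulNr !opprK; congr (_ / _ / _ / _).
- by rewrite mulrC.
- by rewrite mulrC.
Qed.

(** Clearing denominators, both inequalities read n (1 - a) <= 2 (1 + a). *)
Lemma ratio_bounds (a : R) (n : nat) : -1 < a < 1 ->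
  (n%:R - 2) / (n%:R + 2) <= a ->
  let c := (1 - a) / (1 + a) in 0 < c /\ c * n%:R <= 2.
Proof.
move=> /andP[a1 a2]; have n0 : 0 <= n%:R :> R by [].
have n2 : 0 < n%:R + 2 :> R by rewrite ltr_wpDl.
have a0 : 0 < 1 + a by lra.
rewrite ler_pdivrMr// => h; split; first by rewrite divr_gt0// subr_gt0.
by rewrite mulrAC ler_pdivrMr//; lra.
Qed.

End Assembly.

(* H'(0) = 1/(1+a), so the convolution has derivative 1/(1+a) at 0; the positive
   factor 1+a normalises it. *)
Theorem theorem2p3 (R : realType) (n : nat) (theta eta alpha gamma a : R)
    (H G f T1 T2 : R[i] -> R[i])
    (n_gt0 : (0 < n)%N)
    (alpha_range : 0 <= alpha < 2 * pi)
    (gamma_range : 0 <= gamma < 2 * pi)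
    (a_range : -1 < a < 1)
    (F_slanted : S_Hslanted alpha H G)
    (F_dilatation : has_dilatation H G (fun z =>
       cis (2 * alpha) * ((a%:C - z * cis alpha) / (1 - a%:C * z * cis alpha))))
    (f_analytic : analytic_on_disk f)
    (f_derivative : forall z, unit_disk z ->
       z * cderive f z =
       z / ((1 + z * cis (eta + gamma)) * (1 + z * cis (- (eta - gamma)))))
    (T_SH : S_H T1 T2)
    (T_shear : forall z, unit_disk z -> T1 z + cis (- 2 * gamma) * T2 z = f z)
    (T_dilatation : has_dilatation T1 T2 (fun z => cis theta * z ^+ n))
    (a_ge : (n%:R - 2) / (n%:R + 2) <= a) :
  let P := hadamard H T1 in
  let Q := hadamard G T2 in
  S_H (fun z => (1 + a)%:C * P z) (fun z => (1 + a)%:C * Q z) /\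
  maps_convex_in_direction (harmonic_map P Q) (- (alpha + gamma)).

Proof.
move=> P Q.
have [c0 cn] := ratio_bounds a_range a_ge; set c := (1 - a) / (1 + a) in c0 cn.
have [dH dG] := slanted_derivatives a_range erefl F_slanted F_dilatation.
have dT := shear_derivatives n_gt0 f_analytic f_derivative T_SH T_shear T_dilatation.
have [_ _ T10 T20 _] := T_SH.
clear a_ge T_dilatation.
case: n n_gt0 dT cn => [//|k] n_gt0 dT cn.
set zeta := cis alpha; set e := cis gamma; pose e' := cis (- gamma).
pose xi := zeta * e.
have ee : e' * e = 1 by exact: cisNM.
have e'e : cis (- 2 * gamma) = e' * e' by rewrite -cisD; congr cis; ring.
have zeta0 : zeta != 0 := cis_neq0 _.
have e0 : e != 0 := cis_neq0 _.
have zeta1 : `|zeta| <= 1 by rewrite norm_cis.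
have xi1 : nsq xi = 1 by rewrite nsq_mul !nsq_cis mulr1.
have xi0 : xi != 0 by rewrite mulf_neq0.
pose nu := cis (- 2 * gamma) * cis theta.
have nu1 : `|nu| <= 1 by rewrite normrM !norm_cis mulr1.
(* The constant of nu z^n after the substitution z = e' u. *)
pose mu := nu * e' ^+ k.+1.
have mu1 : nsq mu = 1.
  rewrite /mu !nsq_mul !nsq_cis !mul1r; elim: (k.+1) => [|m IH].
    by rewrite expr0 /nsq /= expr1n expr0n addr0.
  by rewrite exprS nsq_mul nsq_cis mul1r.
pose s u := mu * u ^+ k.+1.
pose g u := (quad (cos eta) u * (1 + s u))^-1.
have disk_e' u : unit_disk u -> unit_disk (e' * u).
  by move=> u1; rewrite mulrC; apply: unit_diskM (nsq_cis _).
have gE u : (quad (cos eta) (e' * u * e) * (1 + nu * (e' * u) ^+ k.+1))^-1 = g u.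
  by rewrite /g /s /mu mulrAC ee mul1r exprMn mulrA.
(* The outer factors e and e' are chosen so that the derivatives become exactly g and s g. *)
pose t1 u := e * T1 (e' * u).
pose t2 u := e' * T2 (e' * u).
have lin u : cder (fun u => e' * u) u e'.
  by apply: cder_eq (cderZ e' (cder_id u)) _; rewrite mulr1.
have t1_der u : unit_disk u -> cder t1 u (g u).
  move=> u1; have [_ [d1 _]] := dT _ (disk_e' _ u1).
  apply: cder_eq (cderZ e (cder_comp (lin u) d1)) _.
  by rewrite gE [g u * e']mulrC mulrA [e * e']mulrC ee mul1r.
have t2_der u : unit_disk u -> cder t2 u (s u * g u).
  move=> u1; have [_ [_ d2]] := dT _ (disk_e' _ u1).
  apply: cder_eq (cderZ e' (cder_comp (lin u) d2)) _.
  rewrite gE /s /mu /nu e'e exprMn; ring.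
pose A u := t1 u + c%:C * (u * g u).
pose B u := t2 u - c%:C * (u * (s u * g u)).
have C1 : -1 <= cos eta by exact: cos_geN1.
have C2 : cos eta <= 1 by exact: cos_le1.
have [Finj Fopen Fslice] := shear_image C1 C2 c0 cn mu1 t1_der t2_der.
have dA := A_der c C1 C2 mu1 t1_der.
have dA0 := A_der0 c C1 C2 mu1 t1_der.
have dB := B_der c C1 C2 mu1 t2_der.
rewrite -/(s _) -/(g _) -/(A _) -/(B _) in Finj Fopen Fslice dA dA0 dB.
have wE z : e' * (xi * z) = zeta * z.
  by rewrite /xi [zeta * e]mulrC !mulrA ee mul1r.
(* The factor 1/(2 zeta) of the convolution becomes 1/(2 xi) because [t1] carries e. For Q, kappa =
   zeta^2 leads to xi/2 instead. *)
have PE z : unit_disk z -> P z = A (xi * z) / (2 * xi).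
  have [tb bE] := psum_monomial (1 : R[i]) 0%N.
  have [d td dE] := shear_psum eta gamma n_gt0 nu1 tb.
  have T1d x : unit_disk x -> cder T1 x (psum d x).
    by move=> x1; have [_ [d1 _]] := dT _ x1; rewrite dE// bE expr0 mulr1 mul1r.
  move=> z1; rewrite /P (hadamard_halfplane zeta1 zeta0 dH td T10 T1d z1).
  rewrite dE; last exact: unit_diskZ.
  rewrite bE expr0 mulr1 -/zeta -(wE z) -/e gE /A /t1 wE /xi.
  by rewrite mul1r -/c; field; rewrite zeta0 e0.
have QE z : unit_disk z -> Q z = B (xi * z) * xi / 2.
  have [tb bE] := psum_monomial (cis theta) k.+1.
  have [d td dE] := shear_psum eta gamma n_gt0 nu1 tb.
  have T2d x : unit_disk x -> cder T2 x (psum d x).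
    by move=> x1; have [_ [_ d2]] := dT _ x1; rewrite dE// bE.
  move=> z1; rewrite /Q (hadamard_halfplane zeta1 zeta0 dG td T20 T2d z1).
  rewrite dE; last exact: unit_diskZ.
  rewrite bE -/zeta -(wE z) -/e gE /B /t2 wE.
  have -> : s (xi * z) = e' * e' * cis theta * (zeta * z) ^+ k.+1.
    by rewrite -wE /s /mu /nu e'e [(e' * _) ^+ _]exprMn mulrA.
  have xiE : xi * e' = zeta by rewrite /xi -mulrA [e * e']mulrC ee mulr1.
  rewrite -xiE -/c; move: (g _) (T2 _) => G1 G2.
  have x0 : xi * e' != 0 by rewrite xiE.
  by field; rewrite xi0 cis_neq0.
have FE z : unit_disk z -> harmonic_map P Q z = (A (xi * z) + (B (xi * z))^*) / (2 * xi).
  move=> z1; rewrite /harmonic_map PE// QE//.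
  (* Since |xi| = 1, conjugating xi/2 gives 1/(2 xi), so both parts share one factor. *)
  have xc : (xi^*)%R = xi^-1.
    apply: (mulfI xi0); rewrite mulfV//; apply: etrans (esym (sqr_normc xi)) _.
    by rewrite nsqE xi1.
  have -> : ((B (xi * z) * xi / 2)^* = (B (xi * z))^* * xi^* / 2)%R.
    by rewrite !rmorphM fmorphV rmorph_nat.
  by rewrite xc; field.
have lin' z : cder (fun z => xi * z) z xi.
  by apply: cder_eq (cderZ xi (cder_id z)) _; rewrite mulr1.
have xid z : unit_disk z -> unit_disk (xi * z).
  by move=> z1; rewrite mulrC; exact: unit_diskM.
have A0 : A 0 = 0 by rewrite /A /t1 mulr0 T10 mul0r !mulr0 addr0.
have B0 : B 0 = 0 by rewrite /B /t2 mulr0 T20 mul0r !mulr0 subr0.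
have d0 := unit_disk0 R.
have a0 : 1 + a != 0 by case/andP: a_range => a1 _; rewrite gt_eqF// -ltrBlDl sub0r.
have a0' : (1 + a)%:C != 0 by rewrite eq_complex /= negb_and a0.
have dP z dd : unit_disk z -> cder A (xi * z) dd -> cder (fun z => (1 + a)%:C * P z) z ((1 + a)%:C * (dd / 2)).
  move=> z1 dd1; apply: cderZ.
  have h := cderM (cder_comp (lin' z) dd1) (cder_cst (2 * xi)^-1 z).
  apply: (cder_disk _ z1 (cder_eq h _)) => [x x1|]; first by rewrite PE.
  by rewrite mulr0 add0r; field.
split; last first.
  apply: (image_maps_convex dA dB xi1 _ FE Fopen Fslice).
  by rewrite mulrC (_ : xi = cis (alpha + gamma)) ?cisNM// cisD.
split.
- split=> z z1; first exact: cder_derivable (dP _ _ z1 (dA _ (xid _ z1))).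
  apply: cder_derivable; apply: cderZ.
  have h := cderM (cder_comp (lin' z) (dB _ (xid _ z1))) (cder_cst (xi / 2) z).
  by apply: (cder_disk _ z1 h) => x x1; rewrite QE// mulrA.
- have FE' z : unit_disk z -> harmonic_map (fun z => (1 + a)%:C * P z) (fun z => (1 + a)%:C * Q z) z =
    (1 + a)%:C * ((A (xi * z) + (B (xi * z))^*) / (2 * xi)).
    have cr (u : R[i]) : (((1 + a)%:C * u)^* = (1 + a)%:C * u^*)%R.
      by rewrite rmorphM; congr (_ * _); exact: conjc_real.
    by move=> z1; rewrite -FE// /harmonic_map cr -mulrDr.
  move=> z z' /set_mem z1 /set_mem z1'; rewrite !FE'// => /(mulfI a0') h.
  have rho0 : (2 * xi)^-1 != 0 by rewrite invr_neq0// mulf_neq0// pnatr_eq0.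
  have := Finj (xi * z) (xi * z') (mem_set (xid _ z1)) (mem_set (xid _ z1')) (mulIf rho0 h).
  exact: mulfI.
- by rewrite PE// mulr0 A0 mul0r mulr0.
- by rewrite QE// mulr0 B0 !mul0r mulr0.
- rewrite (cderiveE (dP 0 (1 + c%:C) d0 _)); last by rewrite mulr0.
  (* The derivative of A at 0 is 1 + c = 2/(1 + a); halving it and multiplying by 1 + a gives 1. *)
  have -> : 1 + c%:C = (2 / (1 + a))%:C.
    by rewrite -[1]/(1%:C) -rmorphD; congr (_%:C); rewrite /c; field.
  rewrite rmorphM fmorphV rmorph_nat; field.
  by move: a0'; rewrite rmorphD.
Qed.
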